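(* Let $n\ge 2$, let $X_1,\dots,X_n$ be infinite dimensional Hilbert spaces and $D_k\in\mathcal{B}(X_k)$, $1\le k\le n$. Then for every $A\in\mathcal{B}_n$, $$\bigcup_{k=1}^n\sigma_{lw}(D_k)=\sigma_{lw}(T_n^d(A))\cup\Delta_1\cup\Delta_2,$$ where $$\Delta_1=\bigcup_{k=2}^{n}\Big\{\lambda\in\mathbb{C}:\ \alpha(D_k-\lambda)=\infty,\ \alpha(D_s-\lambda)<\infty \text{ for } 2\le s\le k-1,\ \sum_{s=1}^{k-1}\beta(D_s-\lambda)=\infty\Big\}\cap\rho_{le}(D_1)\cap\Big\{\lambda\in\mathbb{C}:\ \sum_{s=1}^n\beta(D_s-\lambda)\ge\sum_{s=1}^n\alpha(D_s-\lambda)\Big\}$$ (for $k=2$ the condition on $2\le s\le k-1$ is vacuous), and $$\Delta_2=\bigcup_{k=1}^{n}\Big\{\lambda\in\mathbb{C}:\ \alpha(D_s-\lambda)<\infty \text{ for all } 1\le s\le n,\ \sum_{s=1}^n\beta(D_s-\lambda)\ge\sum_{s=1}^n\alpha(D_s-\lambda),\ \text{and } \big(\alpha(D_k-\lambda)>\beta(D_k-\lambda) \text{ or } \mathcal{R}(D_k-\lambda) \text{ is not closed}\big)\Big\}.$$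
   Context: For a bounded operator $T$ between Banach spaces, $\mathcal{N}(T)$ and $\mathcal{R}(T)$ denote its kernel and range, $\alpha(T)=\dim\mathcal{N}(T)$ and $\beta(T)=\operatorname{codim}\mathcal{R}(T)$, each taking values in $\{0,1,2,\dots\}\cup\{\infty\}$; sums and comparisons of these quantities are taken in $\{0,1,\dots\}\cup\{\infty\}$ (a sum is $\infty$ if some term is $\infty$). $\mathrm{ind}(T)=\alpha(T)-\beta(T)$ when at least one is finite. $T$ is left Fredholm if $\alpha(T)<\infty$ and $\mathcal{R}(T)$ is closed and (topologically) complemented; left Weyl if it is left Fredholm with $\mathrm{ind}(T)\le 0$. For $T\in\mathcal{B}(X)$: $\sigma_{le}(T)=\{\lambda:\lambda-T$ not left Fredholm$\}$, $\sigma_{lw}(T)=\{\lambda:\lambda-T$ not left Weyl$\}$, and $\rho_{le}(T)=\mathbb{C}\setminus\sigma_{le}(T)$. $\mathcal{B}_n$ denotes the set of all tuples $A=(A_{ij})_{1\le i<j\le n}$ with $A_{ij}\in\mathcal{B}(X_j,X_i)$, and $T_n^d(A)\in\mathcal{B}(X_1\oplus\cdots\oplus X_n)$ is the upper triangular operator matrix with diagonal entries $D_1,\dots,D_n$, entry $A_{ij}$ in position $(i,j)$ for $i<j$, and zero entries below the diagonal. *)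

(* Defs.v *)
From HB Require Import structures.
From mathcomp Require Import all_boot all_order all_algebra.
From mathcomp Require Import all_classical all_reals all_analysis.
From mathcomp.real_closed Require Import complex.

Set Implicit Arguments.
Unset Strict Implicit.
Unset Printing Implicit Defensive.

Import Order.TTheory GRing.Theory Num.Theory.
Local Open Scope ring_scope.
Local Open Scope classical_set_scope.

(* The complex field.  We work with C := R[i] for an arbitrary         *)
(* realType R (any two such fields are isomorphic to the usual C).    *)

(* Finite direct sums  X_1 (+) ... (+) X_n  of topological vector      *)
(* spaces: the dependent product, with pointwise linear structure and *)
(* the product topology (which, for finitely many normed spaces,      *)
(* coincides with the norm topology of the direct sum).               *)
Section DSum.
Variables (K : numDomainType) (n : nat) (X : 'I_n -> preTopologicalLmodType K).

Definition dsum := forall i, X i.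

HB.instance Definition _ :=
  Topological.copy dsum (prod_topology (fun i => X i : topologicalType)).

Let ext (x y : dsum) : (forall i, x i = y i) -> x = y.
Proof. by move=> h; apply: functional_extensionality_dep. Qed.

Definition dsum_zero : dsum := fun i => 0.
Definition dsum_opp (x : dsum) : dsum := fun i => - x i.
Definition dsum_add (x y : dsum) : dsum := fun i => x i + y i.
Definition dsum_scale (a : K) (x : dsum) : dsum := fun i => a *: x i.

Let dsum_addA : associative dsum_add.
Proof. by move=> x y z; apply: ext => i; rewrite /dsum_add addrA. Qed.
Let dsum_addC : commutative dsum_add.
Proof. by move=> x y; apply: ext => i; rewrite /dsum_add addrC. Qed.
Let dsum_add0 : left_id dsum_zero dsum_add.
Proof. by move=> x; apply: ext => i; rewrite /dsum_add /dsum_zero add0r. Qed.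
Let dsum_addN : left_inverse dsum_zero dsum_opp dsum_add.
Proof. by move=> x; apply: ext => i; rewrite /dsum_add /dsum_opp addNr. Qed.

HB.instance Definition _ :=
  GRing.isZmodule.Build dsum dsum_addA dsum_addC dsum_add0 dsum_addN.

Let dsum_scaleA a b (x : dsum) :
  dsum_scale a (dsum_scale b x) = dsum_scale (a * b) x.
Proof. by apply: ext => i; rewrite /dsum_scale scalerA. Qed.
Let dsum_scale1 : left_id 1 dsum_scale.
Proof. by move=> x; apply: ext => i; rewrite /dsum_scale scale1r. Qed.
Let dsum_scaleDr : right_distributive dsum_scale (@GRing.add dsum).
Proof. by move=> a x y; apply: ext => i; rewrite /dsum_scale scalerDr. Qed.
Let dsum_scaleDl (x : dsum) :
  {morph dsum_scale^~ x : a b / a + b >-> (a + b : dsum)}.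
Proof. by move=> a b; apply: ext => i; rewrite /dsum_scale scalerDl. Qed.

HB.instance Definition _ :=
  GRing.Zmodule_isLmodule.Build K dsum dsum_scaleA dsum_scale1
    dsum_scaleDr dsum_scaleDl.

End DSum.

Definition enat := option nat.
Definition einf : enat := None.
Definition eadd (a b : enat) : enat :=
  match a, b with Some x, Some y => Some (x + y)%N | _, _ => None end.
Definition ele (a b : enat) : bool :=
  match a, b with
  | _, None => true
  | None, Some _ => false
  | Some x, Some y => (x <= y)%N
  end.
Definition elt (a b : enat) : bool := ele a b && (a != b).

Definition enat_min (P : nat -> Prop) : enat :=
  match pselect (exists k, `[< P k >]) with
  | left h => Some (ex_minn h)
  | right _ => None
  end.

Section LinAlg.
Variable K : numFieldType.

Definition span_seq (V : lmodType K) (s : seq V) : set V :=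
  [set v | exists c : nat -> K, v = \sum_(i < size s) c i *: s`_i].

Definition dim_le (V : lmodType K) (S : set V) (k : nat) : Prop :=
  exists s : seq V, size s = k /\ S `<=` span_seq s.

Definition codim_le (V : lmodType K) (S : set V) (k : nat) : Prop :=
  exists s : seq V, size s = k /\
    forall v : V, exists u, S u /\ span_seq s (v - u).

Definition dimension (V : lmodType K) (S : set V) : enat := enat_min (dim_le S).
Definition codimension (V : lmodType K) (S : set V) : enat :=
  enat_min (codim_le S).

Definition kernel (V W : lmodType K) (f : V -> W) : set V := [set x | f x = 0].

Definition alpha (V W : lmodType K) (f : V -> W) : enat := dimension (kernel f).
Definition beta (V W : lmodType K) (f : V -> W) : enat := codimension (range f).

Definition subspace (V : lmodType K) (S : set V) : Prop :=
  S 0 /\ forall a x y, S x -> S y -> S (a *: x + y).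

Definition infinite_dim (V : lmodType K) : Prop :=
  forall k, ~ dim_le [set: V] k.

Definition linear_map (V W : lmodType K) (f : V -> W) : Prop :=
  forall a x y, f (a *: x + y) = a *: f x + f y.

Definition subl (V : lmodType K) (f : V -> V) (l : K) : V -> V :=
  fun x => f x - l *: x.
Definition lsub (V : lmodType K) (l : K) (f : V -> V) : V -> V :=
  fun x => l *: x - f x.
End LinAlg.

Section Spectra.
Variable K : numFieldType.

Definition complemented (W : preTopologicalLmodType K) (M : set W) : Prop :=
  exists N : set W, subspace N /\ closed N /\ M `&` N = [set 0] /\
    forall v : W, exists m w, M m /\ N w /\ v = m + w.

Definition left_fredholm (V W : preTopologicalLmodType K) (f : V -> W) : Prop :=
  alpha f != einf /\ closed (range f) /\ complemented (range f).

(* ind(T) = alpha(T) - beta(T) <= 0, which (alpha(T) being finite)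
   reads alpha(T) <= beta(T) in {0,1,...} U {oo} *)
Definition left_weyl (V W : preTopologicalLmodType K) (f : V -> W) : Prop :=
  left_fredholm f /\ ele (alpha f) (beta f).

Definition sigma_le (V : preTopologicalLmodType K) (f : V -> V) : set K :=
  [set l | ~ left_fredholm (lsub l f)].
Definition sigma_lw (V : preTopologicalLmodType K) (f : V -> V) : set K :=
  [set l | ~ left_weyl (lsub l f)].
Definition rho_le (V : preTopologicalLmodType K) (f : V -> V) : set K :=
  ~` sigma_le f.
End Spectra.

Definition bounded_op (K : numFieldType) (V W : normedModType K) (f : V -> W) :=
  linear_map f /\ exists M : K, forall x, `|f x| <= M * `|x|.

(* ip is an inner product on V inducing the norm of V; for a complete
   normed space V this makes V a Hilbert space *)
Definition inner_product_of_norm (R : realType) (V : normedModType R[i])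
    (ip : V -> V -> R[i]) : Prop :=
  [/\ forall a x y z, ip (a *: x + y) z = a * ip x z + ip y z,
      forall x y, ip x y = (ip y x)^* &
      forall x, ip x x = `|x| ^+ 2].

Definition upper_tri (K : numFieldType) (n : nat) (X : 'I_n -> normedModType K)
    (D : forall k, X k -> X k) (A : forall i j : 'I_n, X j -> X i) :
    dsum (fun k => X k : preTopologicalLmodType K) ->
    dsum (fun k => X k : preTopologicalLmodType K) :=
  fun x i => @D i (x i) + \sum_(j < n | (i < j)%N) @A i j (x j).

(* The sets Delta_1 and Delta_2 (0-based indices: D_1 is D at index 0) *)
Section Deltas.
Variables (K : numFieldType) (n : nat) (X : 'I_n -> normedModType K)
  (D : forall k, X k -> X k).

Definition esum_lt (f : 'I_n -> enat) (k : nat) : enat :=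
  \big[eadd/Some 0%N]_(s < n | (s < k)%N) f s.
Definition esum_all (f : 'I_n -> enat) : enat := \big[eadd/Some 0%N]_(s < n) f s.

Definition alphaD (l : K) (s : 'I_n) : enat := alpha (subl (@D s) l).
Definition betaD (l : K) (s : 'I_n) : enat := beta (subl (@D s) l).

Definition Delta1 : set K :=
  (\bigcup_(k in [set k : 'I_n | (1 <= k)%N])
     [set l | alphaD l k = einf /\
              (forall s : 'I_n, (1 <= s < k)%N -> alphaD l s != einf) /\
              esum_lt (betaD l) k = einf])
  `&` (\bigcap_(s in [set s : 'I_n | nat_of_ord s = 0%N])
         rho_le (@D s : (X s : preTopologicalLmodType K) -> X s))
  `&` [set l | ele (esum_all (alphaD l)) (esum_all (betaD l))].

Definition Delta2 : set K :=
  \bigcup_(k in [set: 'I_n])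
    [set l | (forall s : 'I_n, alphaD l s != einf) /\
             ele (esum_all (alphaD l)) (esum_all (betaD l)) /\
             (elt (betaD l k) (alphaD l k) \/
              ~ closed (range (subl (@D k) l)))].
End Deltas.

(* Main.v *)
Require Import Defs.
From HB Require Import structures.
From mathcomp Require Import all_boot all_order all_algebra.
From mathcomp Require Import all_classical all_reals all_analysis.
From mathcomp.real_closed Require Import complex.
From mathcomp Require Import ring lra zify.
Import Order.TTheory GRing.Theory Num.Theory.
Local Open Scope ring_scope.
Local Open Scope classical_set_scope.
Set Implicit Arguments.
Unset Strict Implicit.
Unset Printing Implicit Defensive.

(** Fix [l], put [t k = D_k - l] and let [T] be the operator matrix minus [l].

    Index bookkeeping is algebraic.  Along the filtration of the direct sum by
    the subspaces [fil k] of vectors supported on the first [k] coordinates,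
    the six-term kernel-cokernel sequence gives [d] with
    [a_(k+1) + d = a_k + alpha (t k)] and [b_(k+1) + d = b_k + beta (t k)],
    where [a_k], [b_k] are the nullity and defect of [T] on [fil k], and [d] is
    bounded by both [alpha (t k)] and [b_k].  Hence [alpha T <= beta T] when all
    [t k] satisfy the same with finite nullities; the sums of nullities and
    defects compare as soon as [alpha T <= beta T]; and at the first [k] with
    [alpha (t k)] infinite, finite defects of the previous entries would force
    [alpha T] to be infinite.

    Topologically, a linear map between Hilbert spaces is left Fredholm iff its
    nullity is finite and its range is closed.  If all [t k] are such, [T] is
    bounded below on the closed finite-codimensional space of vectors whose
    coordinates are orthogonal to the kernels, so its range is closed.
    Conversely, by the open mapping theorem an operator with closed range and
    finite-dimensional kernel maps closed subspaces to closed ones; applied to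
    the first summand this shows that the first entry has closed range. *)

(* [all_analysis] also exports a [kernel] and a [subspace]. *)
Local Notation subspace := Defs.subspace.
Local Notation kernel := Defs.kernel.

(** * Relative dimension and the kernel-cokernel sequence *)

Section EnatMin.
Implicit Types P Q : nat -> Prop.

Lemma enat_minP P : 
  (exists2 k, enat_min P = Some k & P k /\ forall j, P j -> (k <= j)%N) \/
  (enat_min P = None /\ forall j, ~ P j).
Proof.
rewrite /enat_min; case: pselect => [h|h].
  left; case: ex_minnP => k /asboolP Pk kmin; exists k => //; split => // j Pj.
  by apply: kmin; apply/asboolP.
by right; split=> // j Pj; apply: h; exists j; apply/asboolP.
Qed.

Lemma enat_min_fin P : (exists k, P k) <-> enat_min P != einf.
Proof.
case: (enat_minP P) => [[k -> [Pk _]]|[-> h]]; split=> //.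
  by move=> _; exists k.
by move=> [k /h].
Qed.

Lemma enat_min_ext P Q : (forall k, P k <-> Q k) -> enat_min P = enat_min Q.
Proof. by move=> PQ; congr enat_min; apply/funext => k; apply/propext. Qed.

End EnatMin.

Lemma eaddA : associative eadd.
Proof. by move=> [a|] [b|] [c|] //=; rewrite addnA. Qed.
Lemma eaddC : commutative eadd.
Proof. by move=> [a|] [b|] //=; rewrite addnC. Qed.
Lemma eadd0 : left_id (Some 0%N) eadd.
Proof. by move=> [a|]. Qed.
(** Lets [bigD1] and the other big-operator lemmas act on [esum_lt] and [esum_all]. *)
HB.instance Definition _ := Monoid.isComLaw.Build enat (Some 0%N) eadd eaddA eaddC eadd0.

Section LinearAlgebra.
Variable K : numFieldType.
Implicit Types V W : lmodType K.

Definition lcomb V (k : nat) (b : 'I_k -> V) (c : 'I_k -> K) : V :=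
  \sum_(i < k) c i *: b i.

(** An upper bound for the dimension of (A + B)/A, covering nullities (A = 0) and defects (B the
    whole space) alike. The family [b] may leave [B], which makes the bound monotone in both
    sets. *)
Definition reldim_le V (A B : set V) (k : nat) : Prop :=
  exists b : 'I_k -> V, forall v, B v -> exists u c, A u /\ v = u + lcomb b c.

Definition reldim V (A B : set V) : enat := enat_min (reldim_le A B).

Definition is_basis V (A B : set V) (k : nat) (b : 'I_k -> V) : Prop :=
  [/\ forall i, B (b i),
      forall c, A (lcomb b c) -> forall i, c i = 0 &
      forall v, B v -> exists u c, A u /\ v = u + lcomb b c].

Lemma span_seqP V (s : seq V) (k : nat) v : size s = k ->
  span_seq s v <-> exists c, v = lcomb (fun i : 'I_k => s`_i) c.
Proof.
move=> <-; split=> [[c ->]|[c ->]].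
  by exists (fun i : 'I_(size s) => c i).
(* [span_seq] takes coefficients indexed by [nat]; they are extended by 0 past the family. *)
exists (fun i : nat => if insub i is Some j then c j else 0).
by apply: eq_bigr => i _; rewrite valK.
Qed.

Lemma span_seq_mkseq V k (b : 'I_k -> V) : 
  exists2 s : seq V, size s = k & forall v, span_seq s v <-> exists c, v = lcomb b c.
Proof.
exists [seq b i | i <- enum 'I_k]; first by rewrite size_map size_enum_ord.
move=> v; have sk : size [seq b i | i <- enum 'I_k] = k by rewrite size_map size_enum_ord.
have E : (fun i : 'I_k => [seq b i | i <- enum 'I_k]`_i) = b.
  apply/funext=> i; rewrite (nth_map i) ?size_enum_ord //.
  by congr b; apply: val_inj; rewrite /= nth_enum_ord.
by have := span_seqP v sk; rewrite E.
Qed.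

Lemma dim_leP V (S : set V) k : dim_le S k <-> reldim_le [set 0] S k.
Proof.
split=> [[s [sk sS]]|[b bS]].
  exists (fun i : 'I_k => s`_i) => v /sS /(span_seqP _ sk) [c ->].
  by exists 0, c; rewrite add0r.
have [s sk sP] := span_seq_mkseq b; exists s; split=> // v /bS [u [c [-> ->]]].
by apply/sP; exists c; rewrite add0r.
Qed.

Lemma codim_leP V (S : set V) k : codim_le S k <-> reldim_le S setT k.
Proof.
split=> [[s [sk sS]]|[b bS]].
  exists (fun i : 'I_k => s`_i) => v _.
  have [u [Su /(span_seqP _ sk) [c E]]] := sS v.
  by exists u, c; split=> //; rewrite -E addrC subrK.
have [s sk sP] := span_seq_mkseq b; exists s; split=> // v.
have [u [c [Su ->]]] := bS v I.
by exists u; split=> //; apply/sP; exists c; rewrite addrAC subrr add0r.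
Qed.

Lemma dimensionE V (S : set V) : dimension S = reldim [set 0] S.
Proof. by apply: enat_min_ext => k; exact: dim_leP. Qed.

Lemma codimensionE V (S : set V) : codimension S = reldim S setT.
Proof. by apply: enat_min_ext => k; exact: codim_leP. Qed.

Section Subspace.
Variables (V : lmodType K) (A : set V).
Hypothesis sA : subspace A.

Lemma mem_sub0 : A 0. Proof. by case: sA. Qed.
Lemma mem_subZ a x : A x -> A (a *: x).
Proof. by move=> Ax; rewrite -[a *: x]addr0; apply: sA.2 => //; exact: mem_sub0. Qed.
Lemma mem_subD x y : A x -> A y -> A (x + y).
Proof. by move=> Ax Ay; rewrite -[x]scale1r; apply: sA.2. Qed.
Lemma mem_subN x : A x -> A (- x).
Proof. by move=> Ax; rewrite -scaleN1r; apply: mem_subZ. Qed.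
Lemma mem_subB x y : A x -> A y -> A (x - y).
Proof. by move=> Ax Ay; apply: mem_subD => //; apply: mem_subN. Qed.
Lemma mem_sub_lcomb k (b : 'I_k -> V) c : (forall i, A (b i)) -> A (lcomb b c).
Proof.
by move=> Ab; apply: big_ind => [||i _]; [exact: mem_sub0|exact: mem_subD|exact: mem_subZ].
Qed.
End Subspace.

Lemma lcombZ V k (b : 'I_k -> V) a c : lcomb b (fun i => a * c i) = a *: lcomb b c.
Proof. by rewrite /lcomb scaler_sumr; apply: eq_bigr => i _; rewrite scalerA. Qed.

Definition famcat V k l (b : 'I_k -> V) (b' : 'I_l -> V) (i : 'I_(k + l)) : V :=
  match fintype.split i with inl j => b j | inr j => b' j end.

Lemma lcomb_cat V k l (b : 'I_k -> V) (b' : 'I_l -> V) c :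
  lcomb (famcat b b') c =
  lcomb b (fun i => c (lshift l i)) + lcomb b' (fun i => c (rshift k i)).
Proof.
rewrite /lcomb big_split_ord /=; congr (_ + _); apply: eq_bigr => i _.
  by rewrite /famcat (unsplitK (inl i)).
by rewrite /famcat (unsplitK (inr i)).
Qed.

Lemma lcomb_cat2 V k l (b : 'I_k -> V) (b' : 'I_l -> V) c c' :
  exists d, lcomb (famcat b b') d = lcomb b c + lcomb b' c'.
Proof.
exists (fun i => match fintype.split i with inl j => c j | inr j => c' j end).
rewrite lcomb_cat; congr (_ + _); congr lcomb; apply/funext=> i.
  by rewrite (unsplitK (inl i)).
by rewrite (unsplitK (inr i)).
Qed.

(* Steinitz: if [k < m], the [m x k] matrix of coefficients of [t] over [s] has a nonzero left kernel. *)
Lemma steinitz V (A B : set V) k m (s : 'I_k -> V) (t : 'I_m -> V) : subspace A ->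
  (forall v, B v -> exists u c, A u /\ v = u + lcomb s c) ->
  (forall i, B (t i)) -> (forall c, A (lcomb t c) -> forall i, c i = 0) ->
  (m <= k)%N.
Proof.
move=> sA sB tB tind; rewrite leqNgt; apply/negP => km.
have /choice [u /choice [c uc]] : forall i, exists u c, A u /\ t i = u + lcomb s c.
  by move=> i; apply: sB.
pose M : 'M[K]_(m, k) := \matrix_(i, j) c i j.
have : kermx M != 0.
  rewrite -mxrank_eq0 mxrank_ker subn_eq0 -ltnNge.
  by apply: leq_ltn_trans (rank_leq_col M) km.
case/rowV0Pn => w /sub_kermxP wM /eqP; apply.
apply/rowP => i; rewrite mxE.
apply: (tind (fun i => w 0 i)).
have -> : lcomb t (fun i => w 0 i) =
    lcomb u (fun i => w 0 i) + lcomb s (fun j => (w *m M) 0 j).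
  under [lcomb s _]eq_bigr do rewrite mxE scaler_suml.
  rewrite exchange_big -big_split; apply: eq_bigr => j _ /=.
  rewrite (uc j).2 scalerDr /lcomb scaler_sumr; congr (_ + _).
  by apply: eq_bigr => l _; rewrite mxE scalerA.
rewrite wM; have -> : lcomb s (fun j => (0 : 'rV[K]_k) 0 j) = 0.
  by rewrite /lcomb big1 // => j _; rewrite mxE scale0r.
by rewrite addr0; apply: mem_sub_lcomb => // j; case: (uc j).
Qed.

(** Take a family in [B], independent modulo [A], of maximal length: [steinitz] bounds the length by
    [k], and maximality makes the family span. *)
Lemma reldim_le_basis V (A B : set V) k : subspace A -> reldim_le A B k ->
  exists2 m, (m <= k)%N & exists b : 'I_m -> V, is_basis A B b.
Proof.
move=> sA [s sB].
pose P m := `[< exists b : 'I_m -> V,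
  (forall i, B (b i)) /\ (forall c, A (lcomb b c) -> forall i, c i = 0) >].
have P0 : exists m, P m.
  by exists 0%N; apply/asboolP; exists (fun=> 0); split=> [[]//|c _ []].
have Pk m : P m -> (m <= k)%N.
  by move=> /asboolP [b [bB bi]]; apply: (steinitz sA sB bB bi).
case: (ex_maxnP P0 Pk) => m Pm mmax; exists m; first exact: Pk.
move: Pm => /asboolP [b [bB bi]]; exists b; split=> // v Bv.
apply: contrapT => nv.
suff /mmax : P m.+1 by rewrite ltnn.
apply/asboolP; rewrite -addn1; exists (famcat b (fun _ : 'I_1 => v)); split.
  by move=> i; rewrite /famcat; case: fintype.splitP.
move=> c; rewrite lcomb_cat {2}/lcomb big_ord1.
set a := c (rshift m ord0) => Ac.
(* Dividing by a nonzero coefficient of [v] would write [v] over [A] and [b], against [nv]. *)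
have a0 : a = 0.
  apply: contrapT => /eqP a0; apply: nv.
  exists (a^-1 *: (lcomb b (fun i => c (lshift 1 i)) + a *: v)),
    (fun i => - a^-1 * c (lshift 1 i)); split; first exact: mem_subZ.
  by rewrite lcombZ scaleNr scalerDr scalerA mulVf // scale1r addrAC subrr add0r.
move: Ac; rewrite a0 scale0r addr0 => /bi h i.
rewrite -(fintype.splitK i); case: (fintype.split i) => j /=; first exact: h.
by rewrite (ord1 j); exact: a0.
Qed.

Lemma basis_reldim V (A B : set V) k (b : 'I_k -> V) : subspace A ->
  is_basis A B b -> reldim A B = Some k.
Proof.
move=> sA [bB bi bs]; rewrite /reldim.
case: (enat_minP (reldim_le A B)) => [[m -> [[s sB] mmin]]|[_ /(_ k)]]; last first.
  by case; exists b.
congr Some; apply/eqP; rewrite eqn_leq mmin; last by exists b.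
exact: (steinitz sA sB bB bi).
Qed.

Lemma reldim_basis V (A B : set V) k : subspace A ->
  reldim A B = Some k <-> exists b : 'I_k -> V, is_basis A B b.
Proof.
move=> sA; split=> [E|[b bb]]; last exact: basis_reldim bb.
move: (E); rewrite /reldim.
case: (enat_minP (reldim_le A B)) => [[m -> [mle mmin]] [mk]|[-> //]].
have [j jm [b bb]] := reldim_le_basis sA mle.
have := basis_reldim sA bb; rewrite E => -[jE]; subst j.
by exists b.
Qed.

Lemma reldim_fin V (A B : set V) : reldim A B != einf <-> exists k, reldim_le A B k.
Proof. by rewrite enat_min_fin. Qed.

Lemma reldim_leW V (A A' B B' : set V) k : A `<=` A' -> B' `<=` B ->
  reldim_le A B k -> reldim_le A' B' k.
Proof.
by move=> AA BB [b bs]; exists b => v /BB /bs [u [c [/AA ? ?]]]; exists u, c.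
Qed.

Lemma reldim_le_trans V (A B C : set V) k l :
  reldim_le A B k -> reldim_le B C l -> reldim_le A C (k + l).
Proof.
move=> [b bs] [b' bs']; exists (famcat b b') => v /bs' [u [c' [/bs [u' [c [Au ->]] ->]]]].
have [d dE] := lcomb_cat2 b b' c c'.
by exists u', d; split=> //; rewrite dE addrA.
Qed.

(** Bases of [B] modulo [A] and of [C] modulo [B] concatenate. In the infinite case, a finite family
    spanning [C] modulo [A] would serve for both pairs. *)
Lemma reldim_add V (A B C : set V) : subspace A -> subspace B -> A `<=` B -> B `<=` C ->
  reldim A C = eadd (reldim A B) (reldim B C).
Proof.
move=> sA sB AB BC.
case E1 : (reldim A B) => [k|]; last first.
  case E : (reldim A C) => [m|//].
  have /reldim_fin [j h] : reldim A C != einf by rewrite E.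
  have /reldim_fin : exists j, reldim_le A B j by exists j; apply: reldim_leW h.
  by rewrite E1.
case E2 : (reldim B C) => [l|]; last first.
  case E : (reldim A C) => [m|//].
  have /reldim_fin [j h] : reldim A C != einf by rewrite E.
  have /reldim_fin : exists j, reldim_le B C j by exists j; apply: reldim_leW h.
  by rewrite E2.
move: E1 E2 => /(reldim_basis _ _ sA)[b [bB bi bs]] /(reldim_basis _ _ sB)[b' [b'C b'i b's]] /=.
apply: (@basis_reldim _ _ _ _ (famcat b b')) => //; split.
- by move=> i; rewrite /famcat; case: fintype.splitP => j _; [apply/BC/bB|apply: b'C].
- move=> c; rewrite lcomb_cat => Ac.
  have Bb : B (lcomb b (fun i => c (lshift l i))) by apply: mem_sub_lcomb.
  (* The first block lies in [B], so independence of [b'] modulo [B] kills the second block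
     first. *)
  have c0 : forall i, c (rshift k i) = 0.
    by apply: (b'i (fun i => c (rshift k i))); rewrite -(addKr (lcomb b (fun i => c (lshift l i))) (lcomb b' _)); apply: mem_subD => //; [apply: mem_subN|apply: AB].
  move: Ac; have -> : lcomb b' (fun i => c (rshift k i)) = 0.
    by rewrite /lcomb big1 // => i _; rewrite c0 scale0r.
  rewrite addr0 => /bi h i; rewrite -(fintype.splitK i); case: (fintype.split i) => j //=.
- move=> v /b's [u [c' [/bs [u' [c [Au ->]] ->]]]].
  have [d dE] := lcomb_cat2 b b' c c'.
  by exists u', d; split=> //; rewrite dE addrA.
Qed.

Section LinearMap.
Variables (V W : lmodType K) (f : V -> W).
Hypothesis lf : linear_map f.
Lemma lin0 : f 0 = 0.
Proof. by have := lf (-1) 0 0; rewrite scaler0 addr0 scaleN1r addNr. Qed.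
Lemma linD x y : f (x + y) = f x + f y.
Proof. by rewrite -[x in LHS]scale1r lf scale1r. Qed.
Lemma linZ a x : f (a *: x) = a *: f x.
Proof. by rewrite -[a *: x]addr0 lf lin0 addr0. Qed.
Lemma linN x : f (- x) = - f x.
Proof. by rewrite -scaleN1r linZ scaleN1r. Qed.
Lemma linB x y : f (x - y) = f x - f y.
Proof. by rewrite linD linN. Qed.
Lemma lin_lcomb k (b : 'I_k -> V) c : f (lcomb b c) = lcomb (f \o b) c.
Proof. by rewrite /lcomb (big_morph f linD lin0); apply: eq_bigr => i _; rewrite linZ. Qed.
Lemma subspace_ker : subspace (kernel f).
Proof. by split=> [|a x y]; rewrite /kernel /= ?lin0 // lf => -> ->; rewrite scaler0 addr0. Qed.
Lemma subspace_image (A : set V) : subspace A -> subspace (f @` A).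
Proof.
move=> sA; split=> [|a _ _ [x Ax <-] [y Ay <-]]; first by exists 0; [exact: mem_sub0|exact: lin0].
by exists (a *: x + y); rewrite ?lf //; apply: sA.2.
Qed.
Lemma subspace_preimage (A : set W) : subspace A -> subspace (f @^-1` A).
Proof. by move=> sA; split=> [|a x y]; rewrite /preimage /= ?lin0 ?lf; [exact: mem_sub0|exact: sA.2]. Qed.
Lemma subspace_range : subspace (range f).
Proof. by apply: subspace_image. Qed.
Lemma reldim_le_image (A B : set V) k : reldim_le A B k -> reldim_le (f @` A) (f @` B) k.
Proof.
move=> [b bs]; exists (f \o b) => _ [v /bs [u [c [Au ->]] <-]].
by exists (f u), c; split; [exists u|rewrite linD lin_lcomb].
Qed.

(* The hypotheses say that f induces an isomorphism B/A -> B'/A'. *)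
Lemma reldim_iso (A B : set V) (A' B' : set W) :
  subspace A -> subspace B -> subspace A' -> A' `<=` B' ->
  (forall x, B x -> B' (f x)) ->
  (forall y, B' y -> exists2 x, B x & A' (y - f x)) ->
  (forall x, B x -> (A' (f x) <-> A x)) ->
  reldim A B = reldim A' B'.
Proof.
move=> sA sB sA' AB' fB fsurj fA.
have fwd k (b : 'I_k -> V) : is_basis A B b -> is_basis A' B' (f \o b).
  move=> [bB bi bs]; split=> [i|c|y /fsurj [x Bx Ay]]; first exact: fB.
    by rewrite -lin_lcomb fA; [exact: bi|apply: mem_sub_lcomb].
  have [u [c [Au E]]] := bs _ Bx; exists (y - f x + f u), c; split.
    apply: mem_subD => //; apply/fA => //.
    have -> : u = x - lcomb b c by rewrite E addrK.
    by apply: mem_subB => //; apply: mem_sub_lcomb.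
  by rewrite -lin_lcomb -addrA -linD -E subrK.
have bwd k (b' : 'I_k -> W) : is_basis A' B' b' -> exists b : 'I_k -> V, is_basis A B b.
  move=> [bB bi bs].
  have /choice [b bP] : forall i, exists x, B x /\ A' (b' i - f x).
    by move=> i; have [x ? ?] := fsurj _ (bB i); exists x.
  have Bc c : B (lcomb b c) by apply: mem_sub_lcomb => // i; case: (bP i).
  have Ac c : A' (lcomb b' c - f (lcomb b c)).
    rewrite lin_lcomb -sumrB; apply: big_ind => [||i _]; first exact: mem_sub0.
      exact: mem_subD.
    by rewrite -scalerBr; apply: mem_subZ => //; case: (bP i).
  exists b; split=> [i|c|x Bx]; first by case: (bP i).
    move=> /(fA _ (Bc c)) h; apply: bi.
    by rewrite -(subrK (f (lcomb b c)) (lcomb b' c)); apply: mem_subD.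
  have [u [c [Au E]]] := bs _ (fB _ Bx); exists (x - lcomb b c), c; split; last by rewrite subrK.
  apply/fA; first by apply: mem_subB.
  have -> : f (x - lcomb b c) = u + (lcomb b' c - f (lcomb b c)).
    by rewrite linB E addrA.
  exact: mem_subD.
case E : (reldim A B) => [k|].
  move: E => /reldim_basis -/(_ sA)[b /fwd bb].
  by rewrite (basis_reldim sA' bb).
case E' : (reldim A' B') => [k|//].
move: E' => /reldim_basis -/(_ sA')[b' /bwd [b bb]].
by move: E; rewrite (basis_reldim sA bb).
Qed.
End LinearMap.

Definition addset V (A B : set V) : set V := [set x | exists2 a, A a & exists2 b, B b & x = a + b].

Lemma subspace_add V (A B : set V) : subspace A -> subspace B -> subspace (addset A B).
Proof.
move=> sA sB; split; first by exists 0; [exact: mem_sub0|exists 0; [exact: mem_sub0|rewrite addr0]].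
move=> a _ _ [x Ax [y By ->]] [x' Ax' [y' By' ->]].
exists (a *: x + x'); first exact: sA.2.
exists (a *: y + y'); first exact: sB.2.
by rewrite scalerDr addrACA.
Qed.

Lemma subspaceI V (A B : set V) : subspace A -> subspace B -> subspace (A `&` B).
Proof.
move=> sA sB; split; first by split; exact: mem_sub0.
by move=> a x y [? ?] [? ?]; split; [apply: sA.2|apply: sB.2].
Qed.

Lemma subspace0 V : subspace [set (0 : V)].
Proof. by split=> // a x y -> ->; rewrite scaler0 addr0. Qed.

Lemma addsetL V (A B : set V) : subspace B -> A `<=` addset A B.
Proof. by move=> sB a Aa; exists a => //; exists 0; [exact: mem_sub0|rewrite addr0]. Qed.
Lemma addsetR V (A B : set V) : subspace A -> B `<=` addset A B.
Proof. by move=> sA b Bb; exists 0; [exact: mem_sub0|exists b => //; rewrite add0r]. Qed.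
Lemma addset_sub V (A B C : set V) : subspace C -> A `<=` C -> B `<=` C -> addset A B `<=` C.
Proof. by move=> sC AC BC _ [a /AC ? [b /BC ? ->]]; apply: mem_subD. Qed.

Lemma linear_map_id V : linear_map (@id V). Proof. by []. Qed.

(** Second isomorphism theorem, induced by the identity map. *)
Lemma reldim_iso2 V (A B : set V) : subspace A -> subspace B ->
  reldim (A `&` B) B = reldim A (addset A B).
Proof.
move=> sA sB; apply: (reldim_iso (@linear_map_id V)) => //.
- exact: subspaceI.
- exact: addsetL.
- exact: addsetR.
- by move=> _ [a Aa [b Bb ->]]; exists b => //; rewrite addrK.
- by move=> x Bx; split=> [|[]].
Qed.

(* The six-term kernel-cokernel sequence of f on V0, V1 and V1/V0; d is the rank of its connecting map. *)
Lemma snake V (f : V -> V) (V0 V1 : set V) : linear_map f -> subspace V0 -> subspace V1 ->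
  V0 `<=` V1 -> f @` V0 `<=` V0 -> f @` V1 `<=` V1 ->
  exists d, 
   [/\ eadd (reldim [set 0] (kernel f `&` V1)) d =
       eadd (reldim [set 0] (kernel f `&` V0)) (reldim V0 [set x | V1 x /\ V0 (f x)]),
      eadd (reldim (f @` V1) V1) d =
       eadd (reldim (f @` V0) V0) (reldim (addset V0 (f @` V1)) V1),
      d != einf \/ reldim V0 [set x | V1 x /\ V0 (f x)] = einf &
      d != einf \/ reldim (f @` V0) V0 = einf].
Proof.
move=> lf s0 s1 V01 f0 f1.
set L := [set x | V1 x /\ V0 (f x)].
have sL : subspace L by apply: subspaceI => //; apply: subspace_preimage.
have sk := subspace_ker lf.
pose K1 := kernel f `&` V1; have sK1 : subspace K1 by apply: subspaceI.
have sK0 : subspace (kernel f `&` V0) by apply: subspaceI.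
have sf0 := subspace_image lf s0; have sf1 := subspace_image lf s1.
(* The map induced on V1/V0 has kernel L/V0. The connecting map sends L/V0 to V0/f(V0) by [f] with
   kernel (V0 + K1)/V0, so [d] is its rank. *)
pose d := reldim (addset V0 K1) L.
have VKL : addset V0 K1 `<=` L.
  apply: addset_sub => // x; first by move=> V0x; split; [exact: V01|apply: f0; exists x].
  by move=> [kx V1x]; split=> //; rewrite kx; exact: mem_sub0.
have sVK := subspace_add s0 sK1.
have E1 : reldim V0 L = eadd (reldim V0 (addset V0 K1)) d.
  by apply: reldim_add => //; exact: addsetL.
have E2 : reldim [set 0] K1 = eadd (reldim [set 0] (kernel f `&` V0)) (reldim V0 (addset V0 K1)).
  rewrite -reldim_iso2 //.
  have -> : V0 `&` K1 = kernel f `&` V0.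
    apply/seteqP; split=> [x [? []]|x [? ?]] //.
    by split=> //; split=> //; apply: V01.
  apply: reldim_add => //; first exact: subspace0.
    by move=> x ->; split; exact: mem_sub0.
  by move=> x [? ?]; split=> //; apply: V01.
have Ed : d = reldim (f @` V0) (f @` L).
  apply: (reldim_iso lf) => //.
  - by move=> _ [x V0x <-]; exists x => //; split; [exact: V01|apply: f0; exists x].
  - by move=> _ [x Lx <-]; exists x => //; rewrite subrr; exact: mem_sub0.
  - move=> x [V1x V0fx]; split=> [[y V0y fxy]|[y V0y [z [kz _] ->]]].
      exists y => //; exists (x - y); last by rewrite addrC subrK.
      by split; [rewrite /kernel /= linB // fxy subrr|apply: mem_subB => //; exact: V01].
    by exists y => //; rewrite linD // kz addr0.
have EL : f @` L = f @` V1 `&` V0.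
  apply/seteqP; split=> [_ [x [? ?] <-]|y [[x ? <-] ?]]; first by split=> //; exists x.
  by exists x.
have sfL := subspace_image lf sL.
have E3 : reldim (f @` V0) V0 = eadd d (reldim (f @` L) V0).
  rewrite Ed; apply: reldim_add => //; last by rewrite EL => x [].
  by move=> _ [x V0x <-]; exists x => //; split; [exact: V01|apply: f0; exists x].
(* Since f(L) is the intersection of f(V1) and V0, the quotient V0/f(L) is the image of [V0] in
   V1/f(V1). *)
have E4 : reldim (f @` L) V0 = reldim (f @` V1) (addset (f @` V1) V0).
  by rewrite EL reldim_iso2.
have EC : addset (f @` V1) V0 = addset V0 (f @` V1).
  apply/seteqP; split=> x [a ? [b ? ->]].
    by exists b => //; exists a => //; rewrite addrC.
  by exists b => //; exists a => //; rewrite addrC.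
have E5 : reldim (f @` V1) V1 = eadd (reldim (f @` V1) (addset V0 (f @` V1)))
    (reldim (addset V0 (f @` V1)) V1).
  apply: reldim_add => //; first exact: subspace_add.
    exact: addsetR.
  exact: addset_sub.
exists d; split.
- by rewrite E1 E2 eaddA.
- by rewrite E5 E3 E4 EC eaddC eaddA.
- by case: d E1 {Ed E3} => [d|]; [left|right; rewrite E1 eaddC].
- by case: d E3 {Ed E1} => [d|]; [left|right; rewrite E3].
Qed.

End LinearAlgebra.

(** * Geometry of Hilbert spaces *)

Section RealAux.
Variable R : realType.
Implicit Types (a b c t e : R).

(** Evaluate at the minimiser t = b / c. This gives Cauchy-Schwarz, and the near-orthogonality of
    minimising sequences in [projection]. *)
Lemma discriminant_le a b c : 0 <= c ->
  (forall t, 0 <= a - 2 * t * b + t ^+ 2 * c) -> b ^+ 2 <= a * c.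
Proof.
rewrite le_eqVlt => /predU1P[<- h|c0 h].
  have [->|b0] := eqVneq b 0; first by rewrite expr0n mulr0.
  (* For c = 0 the expression is affine in t, and takes the value -1 here. *)
  have := h ((a + 1) / (2 * b)); rewrite mulr0 addr0.
  have -> : 2 * ((a + 1) / (2 * b)) * b = a + 1 by field.
  lra.
have := h (b / c); have -> : a - 2 * (b / c) * b + (b / c) ^+ 2 * c = (a * c - b ^+ 2) / c.
  by field; rewrite gt_eqF.
by rewrite pmulr_lge0 ?invr_gt0 // subr_ge0.
Qed.

Definition half (k : nat) : R := 2^-1 ^+ k.

Lemma half_gt0 k : 0 < half k.
Proof. by rewrite exprn_gt0 // invr_gt0. Qed.
Lemma halfS k : half k = 2 * half k.+1.
Proof. by rewrite /half exprS mulrA divff ?mul1r. Qed.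
Lemma half_small c e : 0 < e -> exists k, c * half k < e.
Proof.
move=> e0; pose x := Num.max 0 (c / e).
have x0 : 0 <= x by rewrite le_max lexx.
exists (Num.bound x); have := archi_boundP x0; set n := Num.bound x => xn.
have nx : x < 2 ^+ n.
  by apply: lt_trans xn _; rewrite -natrX ltr_nat ltn_expl.
rewrite /half exprVn ltr_pdivrMr ?exprn_gt0 // mulrC -ltr_pdivrMr //.
by apply: le_lt_trans nx; rewrite le_max lexx orbT.
Qed.

Lemma le_half0 a c : (forall k, a <= c * half k) -> a <= 0.
Proof.
move=> h; rewrite leNgt; apply/negP => a0.
by have [k] := half_small c a0; rewrite ltNge h.
Qed.

End RealAux.

(* The real part of a complex inner product carries the whole geometry; complex linearity enters only through [ripM]. *)
Record hilb (R : realType) (V : lmodType R[i]) := Hilb {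
  rip : V -> V -> R;
  ripDl : forall x y z, rip (x + y) z = rip x z + rip y z;
  ripC : forall x y, rip x y = rip y x;
  ripZl : forall (t : R) x y, rip (t%:C%C *: x) y = t * rip x y;
  ripM : forall a x y, rip (a *: x) (a *: y) = (complex.Re a ^+ 2 + complex.Im a ^+ 2) * rip x y;
  rip_ge0 : forall x, 0 <= rip x x;
  rip_eq0 : forall x, rip x x = 0 -> x = 0;
  rip_complete : forall u : nat -> V,
    (forall e : R, 0 < e -> exists n0, forall m n, (n0 <= m)%N -> (n0 <= n)%N ->
       Num.sqrt (rip (u m - u n) (u m - u n)) < e) ->
    exists l, forall e : R, 0 < e -> exists n0, forall n, (n0 <= n)%N ->
       Num.sqrt (rip (u n - l) (u n - l)) < e }.

Section Hilbert.
Variables (R : realType) (V : lmodType R[i]) (H : hilb V).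
Implicit Types (x y z : V) (t e : R) (M : set V).
Local Notation "x %:C" := (x%:C%C).

Definition hnorm x : R := Num.sqrt (rip H x x).

Lemma rip0l y : rip H 0 y = 0.
Proof. by have := ripDl H 0 0 y; rewrite addr0; lra. Qed.
Lemma ripNl x y : rip H (- x) y = - rip H x y.
Proof. by have := ripDl H (- x) x y; rewrite addNr rip0l; lra. Qed.
Lemma ripBl x y z : rip H (x - y) z = rip H x z - rip H y z.
Proof. by rewrite ripDl ripNl. Qed.
Lemma ripDr x y z : rip H x (y + z) = rip H x y + rip H x z.
Proof. by rewrite ripC ripDl !(ripC H x). Qed.
Lemma ripNr x y : rip H x (- y) = - rip H x y.
Proof. by rewrite ripC ripNl ripC. Qed.
Lemma ripBr x y z : rip H x (y - z) = rip H x y - rip H x z.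
Proof. by rewrite ripDr ripNr. Qed.
Lemma ripZr t x y : rip H x (t%:C *: y) = t * rip H x y.
Proof. by rewrite ripC ripZl ripC. Qed.
Lemma rip0r y : rip H y 0 = 0. Proof. by rewrite ripC rip0l. Qed.

Lemma hnorm_ge0 x : 0 <= hnorm x. Proof. exact: sqrtr_ge0. Qed.
Lemma hnorm_sqr x : hnorm x ^+ 2 = rip H x x. Proof. by rewrite sqr_sqrtr // rip_ge0. Qed.
Lemma hnorm0 : hnorm 0 = 0. Proof. by rewrite /hnorm rip0l sqrtr0. Qed.
Lemma hnorm_eq0 x : hnorm x = 0 -> x = 0.
Proof. by move=> h; apply: (@rip_eq0 _ _ H); rewrite -hnorm_sqr h expr0n. Qed.
Lemma hnormN x : hnorm (- x) = hnorm x. Proof. by rewrite /hnorm ripNl ripNr opprK. Qed.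
Lemma hnormBC x y : hnorm (x - y) = hnorm (y - x). Proof. by rewrite -hnormN opprB. Qed.
Lemma hnormM a x : hnorm (a *: x) = Num.sqrt (complex.Re a ^+ 2 + complex.Im a ^+ 2) * hnorm x.
Proof. by rewrite /hnorm ripM sqrtrM // addr_ge0 // sqr_ge0. Qed.
Lemma hnormZ t x : hnorm (t%:C *: x) = `|t| * hnorm x.
Proof. by rewrite hnormM /= expr0n addr0 sqrtr_sqr. Qed.

Lemma cauchy_schwarz x y : `|rip H x y| <= hnorm x * hnorm y.
Proof.
rewrite -(@ler_pXn2r _ 2) ?nnegrE ?mulr_ge0 ?hnorm_ge0 //.
rewrite exprMn !hnorm_sqr real_normK ?num_real //.
apply: discriminant_le; first exact: rip_ge0.
move=> t; have := rip_ge0 H (x - t%:C *: y).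
by rewrite ripBl !ripBr !ripZl !ripZr (ripC H y); lra.
Qed.

Lemma hnormD x y : hnorm (x + y) <= hnorm x + hnorm y.
Proof.
rewrite -(@ler_pXn2r _ 2) ?nnegrE ?addr_ge0 ?hnorm_ge0 //.
rewrite hnorm_sqr ripDl !ripDr (ripC H y x) sqrrD !hnorm_sqr.
by have := cauchy_schwarz x y; rewrite ler_norml => /andP[]; lra.
Qed.

Lemma hnormB x y : hnorm (x - y) <= hnorm x + hnorm y.
Proof. by rewrite -(hnormN y) hnormD. Qed.

Lemma hnorm_trans x y z : hnorm (x - z) <= hnorm (x - y) + hnorm (y - z).
Proof. by rewrite -(subrKA y x); exact: hnormD. Qed.

Lemma hnormE_le x e : 0 <= e -> rip H x x <= e ^+ 2 -> hnorm x <= e.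
Proof. by move=> e0; rewrite -hnorm_sqr ler_pXn2r ?nnegrE ?hnorm_ge0. Qed.

(** Completeness in the form used for minimising sequences, nested balls and successive
    approximation: steps of size c 2^-k leave a tail of at most 2c 2^-k. *)
Lemma geometric_limit (u : nat -> V) (c : R) :
  (forall k, hnorm (u k.+1 - u k) <= c * half R k) ->
  exists l, forall k, hnorm (u k - l) <= 2 * c * half R k.
Proof.
move=> uc.
(* The subtracted term is the rest of the geometric tail; it makes the induction on [m] close. *)
have tail k m : hnorm (u (k + m)%N - u k) <= 2 * c * half R k - 2 * c * half R (k + m).
  elim: m => [|m IH]; first by rewrite addn0 !subrr hnorm0.
  have := hnorm_trans (u (k + m.+1)%N) (u (k + m)%N) (u k).
  by have := uc (k + m)%N; have := halfS R (k + m); rewrite addnS; nra.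
have c0 : 0 <= c.
  have := le_trans (hnorm_ge0 _) (uc 0%N); by rewrite pmulr_lge0 // half_gt0.
have tail' k m : (k <= m)%N -> hnorm (u m - u k) <= 2 * c * half R k.
  move=> km; have := tail k (m - k)%N; rewrite subnKC // => h.
  apply: le_trans h _; rewrite gerBl //.
  by apply: mulr_ge0; [lra|exact/ltW/half_gt0].
have [|l ul] := @rip_complete _ _ H u.
  move=> e e0; have [k ke] := half_small (4 * c) e0; exists k => m n km kn.
  apply: le_lt_trans (hnorm_trans _ (u k) _) _; rewrite (hnormBC (u k)).
  by have := tail' _ _ km; have := tail' _ _ kn; lra.
exists l => k; apply/ler_addgt0Pr => e e0; have [n0 h] := ul e e0.
apply: le_trans (hnorm_trans _ (u (maxn n0 k)) _) _.
have := tail' k _ (leq_maxr n0 k); rewrite (hnormBC (u k)).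
by have := h _ (leq_maxl n0 k); rewrite -/(hnorm _) -/(hnorm _); lra.
Qed.

(** Closedness in the norm of [H]; [closed_nclosed] and [dsum_closed_nclosed] match it with
    topological closedness. *)
Definition nclosed M : Prop :=
  forall x, (forall e, 0 < e -> exists2 y, M y & hnorm (y - x) < e) -> M x.

(** Real scalars suffice for projections, and a complex line will be added to a closed subspace as
    two real lines, the first of which may break complex linearity. *)
Definition rsubspace M : Prop :=
  [/\ M 0, forall x y, M x -> M y -> M (x + y) & forall t x, M x -> M (t%:C *: x)].

Lemma subspace_rsubspace M : subspace M -> rsubspace M.
Proof. by move=> sM; split; [exact: mem_sub0|exact: mem_subD|move=> t x; exact: mem_subZ]. Qed.

Lemma rsubB M x y : rsubspace M -> M x -> M y -> M (x - y).
Proof. by move=> [_ MD MZ] Mx My; apply: MD => //; have := MZ (-1) _ My; rewrite rmorphN1 scaleN1r. Qed.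

Definition orth M : set V := [set x | forall z, M z -> rip H x z = 0].

Lemma projection M x : rsubspace M -> nclosed M -> exists2 m, M m & orth M (x - m).
Proof.
move=> sM cM; have [M0 MD MZ] := sM.
pose q m := rip H (x - m) (x - m).
pose d := inf (q @` M).
have infq : has_inf (q @` M).
  split; first by exists (q 0); exists 0.
  by exists 0 => _ [m _ <-]; exact: rip_ge0.
have dq m : M m -> d <= q m by move=> Mm; apply: ge_inf; [exact: infq.2|exists m].
have /choice [u uP] : forall k, exists m, M m /\ q m < d + half R k ^+ 2.
  move=> k; have e0 : 0 < half R k ^+ 2 by rewrite exprn_gt0 // half_gt0.
  by have [_ [m Mm <-] h] := inf_adherent e0 infq; exists m.
have Mu k : M (u k) by case: (uP k).
have qE m t z : q (m + t%:C *: z) = q m - 2 * t * rip H (x - m) z + t ^+ 2 * rip H z z.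
  rewrite /q opprD addrA; move: (x - m) => w.
  by rewrite !ripBl !ripBr !ripZl !ripZr (ripC H z w); ring.
(* Here q (u k + t z) >= d for every real t, and q (u k) exceeds d by less than half(k)^2. *)
have small k z : M z -> `|rip H (x - u k) z| <= half R k * hnorm z.
  move=> Mz; rewrite -(@ler_pXn2r _ 2) ?nnegrE ?mulr_ge0 ?hnorm_ge0 ?(ltW (half_gt0 _ _)) //.
  rewrite exprMn hnorm_sqr real_normK ?num_real //.
  apply: discriminant_le; first exact: rip_ge0.
  move=> t; have := dq _ (MD _ _ (Mu k) (MZ t z Mz)); rewrite qE.
  by have := (uP k).2; lra.
(* By the parallelogram law at the midpoint, the squared step is below 10 half(k+1)^2, well under
   the 64 half(k+1)^2 that the constant 4 allows. *)
have [|l ul] := @geometric_limit u 4.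
  move=> k; apply: hnormE_le; first by rewrite mulr_ge0 // ltW // half_gt0.
  have Mm : M (u k + (2^-1)%:C *: (u k.+1 - u k)).
    by apply: MD => //; apply: MZ; apply: rsubB.
  have := dq _ Mm; rewrite qE.
  have := (uP k).2; have := (uP k.+1).2.
  have -> : q (u k.+1) = q (u k + 1%:C *: (u k.+1 - u k)).
    by rewrite rmorph1 scale1r addrC subrK.
  rewrite qE; set a := rip H _ (u k.+1 - u k); set b := rip H _ _.
  have := halfS R k; have := half_gt0 R k.+1.
  set h := half R k.+1 => h0 ->; nra.
have Ml : M l.
  apply: cM => e e0; have [k ke] := half_small (2 * 4) e0; exists (u k) => //.
  exact: le_lt_trans (ul k) ke.
exists l => // z Mz.
(* 9 = 1 + 2 * 4: one from [small], eight from the distance between [u k] and [l]. *)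
apply/eqP; rewrite -normr_le0; apply: (@le_half0 _ _ (9 * hnorm z)) => k.
have -> : x - l = (x - u k) + (u k - l) by rewrite subrKA.
rewrite ripDl; apply: le_trans (ler_normD _ _) _.
have := small k _ Mz; have := cauchy_schwarz (u k - l) z.
have := ler_wpM2r (hnorm_ge0 z) (ul k).
by lra.
Qed.

(** For a nonzero, [ripM] turns rip (a x) z into |a|^2 rip x (a^-1 z), and a^-1 z is still in
    [M]. *)
Lemma orth_sub M : subspace M -> subspace (orth M).
Proof.
move=> sM; split=> [z _|a x y ox oy z Mz]; first exact: rip0l.
rewrite ripDl (oy _ Mz) addr0; have [->|a0] := eqVneq a 0; first by rewrite scale0r rip0l.
rewrite -[z](scale1r z) -(divff a0) -scalerA ripM ox ?mulr0 //.
exact: mem_subZ.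
Qed.

Lemma orth_closed M : nclosed (orth M).
Proof.
move=> x h z Mz; apply/eqP; rewrite -normr_le0; apply: (@le_half0 _ _ (hnorm z)) => k.
have [y oy yx] := h _ (half_gt0 R k).
have -> : rip H x z = - rip H (y - x) z by rewrite ripBl oy // sub0r opprK.
rewrite normrN; apply: le_trans (cauchy_schwarz _ _) _.
by rewrite mulrC ler_wpM2l ?hnorm_ge0 // ltW.
Qed.

Lemma orth_cap M x : M x -> orth M x -> x = 0.
Proof. by move=> Mx /(_ _ Mx); exact: rip_eq0. Qed.

(** Every point of [L] is at distance at least |w0| from [x], where [w0] is the part of [x]
    orthogonal to [M] and [v]; so [w0] vanishes at a limit point. *)
Lemma closed_add_rline M v : rsubspace M -> nclosed M ->
  let L := [set x | exists m t, M m /\ x = m + t%:C *: v] in rsubspace L /\ nclosed L.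
Proof.
move=> sM cM L; have [M0 MD MZ] := sM; split.
  split; first by exists 0, 0; split=> //; rewrite rmorph0 scale0r addr0.
    move=> _ _ [m [t [Mm ->]]] [m' [t' [Mm' ->]]]; exists (m + m'), (t + t').
    by split; [exact: MD|rewrite rmorphD scalerDl addrACA].
  move=> s _ [m [t [Mm ->]]]; exists (s%:C *: m), (s * t).
  by split; [exact: MZ|rewrite rmorphM scalerDr scalerA].
move=> x xL.
have [p Mp op] := projection v sM cM.
have [px Mpx opx] := projection x sM cM.
pose v' := v - p; pose w := x - px.
(* If [v] lies in [M], then v' = 0 and the division by zero returns c = 0, which still makes [w0]
   orthogonal to v'. *)
pose c := rip H w v' / rip H v' v'.
pose w0 := w - c%:C *: v'.
have w0M : orth M w0 by move=> z Mz; rewrite ripBl ripZl opx // op // mulr0 subrr.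
have w0v : rip H w0 v' = 0.
  rewrite ripBl ripZl /c.
  have [/rip_eq0 ->|v0] := eqVneq (rip H v' v') 0; first by rewrite !rip0r mulr0 subrr.
  by rewrite divfK // subrr.
suff w00 : w0 = 0.
  exists (px - c%:C *: p), c; split; first by apply: rsubB => //; exact: MZ.
  have : x - px = c%:C *: v' by apply/eqP; rewrite -subr_eq0 -/w -/w0 w00.
  by rewrite scalerBr => E; rewrite -addrA (addrC (- _)) -E addrC subrK.
apply: hnorm_eq0; apply/eqP; rewrite eq_le hnorm_ge0 andbT.
apply/ler_addgt0Pl => e e0; rewrite addr0; have [_ [m [t [Mm ->]]] h] := xL _ e0.
have yE : m + t%:C *: v - x = (m + t%:C *: p - px) + (t - c)%:C *: v' - w0.
  have {1}-> : v = p + v' by rewrite addrC subrK.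
  have {1}-> : x = px + c%:C *: v' + w0.
    by rewrite -addrA (addrC (c%:C *: v')) subrK addrC subrK.
  by rewrite scalerDr opprD !addrA; congr (_ - _); rewrite opprD addrACA rmorphB scalerBl.
have : rip H (m + t%:C *: v - x) w0 = - hnorm w0 ^+ 2.
  rewrite yE ripBl ripDl ripZl hnorm_sqr (ripC H v') w0v mulr0 addr0 (ripC H _ w0) w0M ?sub0r //.
  by apply: rsubB => //; apply: MD => //; exact: MZ.
have := cauchy_schwarz (m + t%:C *: v - x) w0; rewrite ler_norml => /andP[h' _] E.
rewrite E lerN2 expr2 in h'.
have [->|w0n] := eqVneq (hnorm w0) 0; first exact: ltW.
apply/ltW; apply: le_lt_trans h; rewrite -(@ler_pM2r _ (hnorm w0)) //.
by rewrite lt_neqAle eq_sym w0n hnorm_ge0.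
Qed.

Lemma nclosed_ext M M' : (forall x, M x <-> M' x) -> nclosed M -> nclosed M'.
Proof. by move=> E; have -> : M = M' by apply/funext => x; exact/propext. Qed.

(** Each complex coefficient is split into its real and imaginary parts, adding the real lines
    through [b ord0] and i times [b ord0]. *)
Lemma closed_add_lcomb M k (b : 'I_k -> V) : rsubspace M -> nclosed M ->
  let L := [set x | exists m c, M m /\ x = m + lcomb b c] in rsubspace L /\ nclosed L.
Proof.
elim: k b => [|k IH] b sM cM L.
  have -> : L = M.
    apply/seteqP; split=> [_ [m [c [Mm ->]]]|x Mx]; first by rewrite /lcomb big_ord0 addr0.
    by exists x, (fun=> 0); rewrite /lcomb big_ord0 addr0.
  by [].
have [s1 c1] := IH (fun i => b (lift ord0 i)) sM cM.
have [s2 c2] := closed_add_rline (b ord0) s1 c1.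
have [s3 c3] := closed_add_rline ('i%C *: b ord0) s2 c2.
move: s3 c3; set L3 := (X in rsubspace X) => s3 c3; suff -> : L = L3 by [].
apply/seteqP; split=> [_ [m [c [Mm ->]]]|].
  exists (m + lcomb (fun i => b (lift ord0 i)) (fun i => c (lift ord0 i)) + (complex.Re (c ord0))%:C *: b ord0),
    (complex.Im (c ord0)).
  split; last first.
    rewrite scalerA -addrA -scalerDl mulrC -complexE /lcomb big_ord_recl.
    by rewrite -addrA; congr (_ + _); rewrite addrC.
  by eexists; eexists; split; [exists m; eexists; split; [exact: Mm|reflexivity]|reflexivity].
move=> _ [_ [t [[_ [s [[m [c [Mm ->]]] ->]]] ->]]].
exists m, (fun i => if unlift ord0 i is Some j then c j else s%:C + t%:C * 'i%C).
split=> //; rewrite /lcomb big_ord_recl unlift_none.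
under [X in _ = _ + (_ + X)]eq_bigr do rewrite liftK.
by rewrite scalerA -!addrA -scalerDl; congr (_ + _); rewrite addrC.
Qed.

Lemma closed_finite_ext M B k : subspace M -> nclosed M -> subspace B -> M `<=` B ->
  reldim_le M B k -> nclosed B.
Proof.
move=> sM cM sB MB /(reldim_le_basis sM) [m _ [b [bB _ bs]]].
have [_] := closed_add_lcomb b (subspace_rsubspace sM) cM.
apply: nclosed_ext => x; split=> [[u [c [Mu ->]]]|/bs //].
by apply: mem_subD => //; [exact: MB|exact: mem_sub_lcomb].
Qed.

End Hilbert.

(** * Operators with closed range *)

(** Baire's theorem inside [S]: some [A n] is dense in a relative ball. Otherwise nested balls, the
    next one avoiding [A n] at stage n, shrink to a point of [S] in no [A n]. *)
Lemma baire_closed (R : realType) (W : lmodType R[i]) (H : hilb W)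
    (S : set W) (A : nat -> set W) : S !=set0 -> nclosed H S ->
    (forall y, S y -> exists n, A n y) ->
  exists n y0 r, [/\ 0 < r, S y0 & forall y, S y -> hnorm H (y - y0) < r ->
    forall e, 0 < e -> exists2 z, A n z & hnorm H (z - y) < e].
Proof.
move=> [w Sw] cS SA; apply: contrapT => no.
have /choice [g gP] : forall q : nat * (W * R), exists p : W * R,
    S q.2.1 /\ 0 < q.2.2 -> [/\ S p.1, 0 < p.2, hnorm H (p.1 - q.2.1) < q.2.2,
      p.2 * 2 <= q.2.2 & forall z, A q.1 z -> 4 * p.2 <= hnorm H (z - p.1)].
  move=> [n [y r]] /=; have [[Sy r0]|] := pselect (S y /\ 0 < r); last first.
    by move=> h; exists (y, r).
  apply: contrapT => h; apply: no; exists n, y, r; split=> // y' Sy' yy' e e0.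
  (* With e / 4 the centre stays four radii away from [A n]; with r / 2 the later centres stay
     within two radii. *)
  apply: contrapT => h'; apply: h; exists (y', Num.min (r / 2) (e / 4)) => _ /=.
  split=> //.
  - by rewrite lt_min !divr_gt0.
  - by rewrite -ler_pdivlMr // ge_min lexx.
  - move=> z Az; rewrite mulrC -ler_pdivlMr // ge_min; apply/orP; right.
    rewrite ler_pM2r ?invr_gt0 // leNgt; apply/negP => zy; apply: h'.
    by exists z.
pose s := fix s k := if k is k'.+1 then g (k', s k') else (w, 1 : R).
have sP k : S (s k).1 /\ 0 < (s k).2.
  by elim: k => [|k IH] //=; have [? ? _ _ _] := gP (k, s k) IH.
have sS k : [/\ hnorm H ((s k.+1).1 - (s k).1) < (s k).2,
    (s k.+1).2 * 2 <= (s k).2 & forall z, A k z -> 4 * (s k.+1).2 <= hnorm H (z - (s k.+1).1)].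
  by have [] := gP (k, s k) (sP k).
have rk k : (s k).2 <= 1 * half R k.
  elim: k => [|k IH]; first by rewrite /half expr0 mulr1.
  by have [_ h _] := sS k; have := halfS R k; lra.
have [|l ul] := @geometric_limit _ _ H (fun k => (s k).1) 1.
  by move=> k; have [/ltW h _ _] := sS k; apply: le_trans h (rk k).
have tail k m : hnorm H ((s (k + m)%N).1 - (s k).1) <= 2 * (s k).2 - 2 * (s (k + m)%N).2.
  elim: m => [|m IH]; first by rewrite addn0 !subrr hnorm0.
  have := hnorm_trans H (s (k + m.+1)%N).1 (s (k + m)%N).1 (s k).1.
  by rewrite addnS; have [h1 h2 _] := sS (k + m)%N; lra.
have lk k : hnorm H ((s k).1 - l) <= 2 * (s k).2.
  apply/ler_addgt0Pr => e e0; have [m me] := half_small (2 * 1) e0.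
  apply: le_trans (hnorm_trans H _ (s (k + m)%N).1 _) _; rewrite hnormBC.
  have := tail k m; have := ul (k + m)%N; have [_] := sP (k + m)%N.
  have : half R (k + m) <= half R m.
    by rewrite /half exprD ler_piMl ?exprn_ile1 // ?exprn_ge0 ?invr_ge0 // invf_le1 // ler1n.
  by lra.
have Sl : S l.
  by apply: cS => e e0; have [k ke] := half_small (2 * 1) e0; exists (s k).1;
    [case: (sP k)|exact: le_lt_trans (ul k) ke].
(* Being in [A n], the limit is at least four radii from centre n.+1, while [lk] puts it within
   two. *)
have [n Anl] := SA _ Sl.
have [_ _ /(_ _ Anl)] := sS n; rewrite hnormBC.
by have := lk n.+1; have [_] := sP n.+1; lra.
Qed.

Section Operators.
Variables (R : realType) (V W : lmodType R[i]) (HV : hilb V) (HW : hilb W).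
Variables (f : V -> W) (c : R).
Hypotheses (lf : linear_map f) (c0 : 0 <= c).
Hypothesis fc : forall x, hnorm HW (f x) <= c * hnorm HV x.
Local Notation "x %:C" := (x%:C%C).

(** By [baire_closed], images of some ball of radius n are dense in a ball of the range. Subtracting
    approximations of [y0 + t y] and [y0] and rescaling approximates [y] up to half its norm. *)
Lemma almost_open : nclosed HW (range f) -> exists2 C, 0 <= C &
  forall y, range f y -> exists x, hnorm HV x <= C * hnorm HW y /\
    hnorm HW (y - f x) <= hnorm HW y / 2.
Proof.
move=> cR; have sR := subspace_range lf.
have [||n [y0 [r [r0 Ry0 h]]]] := @baire_closed _ _ HW (range f)
    (fun n => [set f x | x in [set x | hnorm HV x <= n%:R]]) _ cR.
- by exists 0; exact: mem_sub0.
- move=> _ [x _ <-]; exists (Num.bound (hnorm HV x)); exists x => //.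
  by apply/ltW/archi_boundP/hnorm_ge0.
exists (4 * n%:R / r); first by rewrite divr_ge0 ?mulr_ge0 ?ler0n // ltW.
move=> y Ry; have [y0'|yn0] := eqVneq (hnorm HW y) 0.
  by exists 0; rewrite hnorm0 (lin0 lf) subr0 y0' mulr0 mul0r.
have yp : 0 < hnorm HW y by rewrite lt_neqAle eq_sym yn0 hnorm_ge0.
(* This scales [y] to norm r / 2, inside the ball; two errors of r / 8 add up to r / 4, which is t
   times half the norm of [y]. *)
pose t := r / (2 * hnorm HW y).
have t0 : 0 < t by rewrite divr_gt0 // mulr_gt0.
have tE : t * hnorm HW y = r / 2 by rewrite /t; field.
have e0 : 0 < r / 8 by rewrite divr_gt0.
have [||_ [x1 x1n <-] x1e] := h (y0 + t%:C *: y) _ _ _ e0.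
- by apply: mem_subD => //; apply: mem_subZ.
- by rewrite addrC addKr hnormZ gtr0_norm // tE; lra.
have [|_ [x2 x2n <-] x2e] := h y0 Ry0 _ _ e0; first by rewrite subrr hnorm0.
have tn0 : t%:C != 0 :> R[i] by rewrite fmorph_eq0 gt_eqF.
exists ((t^-1)%:C *: (x1 - x2)); rewrite hnormZ gtr0_norm ?invr_gt0 //; split.
  have -> : 4 * n%:R / r * hnorm HW y = t^-1 * (2 * n%:R).
    by rewrite /t; field; rewrite yn0 gt_eqF.
  rewrite ler_pM2l ?invr_gt0 //; apply: le_trans (hnormB HV _ _) _.
  by move: x1n x2n => /=; lra.
have -> : y - f ((t^-1)%:C *: (x1 - x2)) =
    (t^-1)%:C *: ((f x2 - y0) - (f x1 - (y0 + t%:C *: y))).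
  have -> : f x2 - y0 - (f x1 - (y0 + t%:C *: y)) = t%:C *: y - (f x1 - f x2).
    by rewrite !opprB !addrA subrK (addrC (f x2)).
  by rewrite (linZ lf) (linB lf) [RHS]scalerBr scalerA -rmorphM mulVf ?gt_eqF // scale1r.
rewrite hnormZ gtr0_norm ?invr_gt0 // ler_pdivrMl //.
have -> : t * (hnorm HW y / 2) = r / 4 by rewrite mulrA tE; lra.
by apply: le_trans (hnormB HW _ _) _; lra.
Qed.

(** Iterating [almost_open] on the residual halves it each time, so the corrections form a geometric
    series whose sum is an exact preimage. *)
Lemma open_mapping : nclosed HW (range f) -> exists2 C, 0 <= C &
  forall y, range f y -> exists x, f x = y /\ hnorm HV x <= C * hnorm HW y.
Proof.
move=> cR; have sR := subspace_range lf.
have [C C0 hC] := almost_open cR.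
have /choice [g gP] : forall y, exists x, range f y -> hnorm HV x <= C * hnorm HW y /\
    hnorm HW (y - f x) <= hnorm HW y / 2.
  move=> y; have [/hC [x ?]|] := pselect (range f y); first by exists x.
  by move=> h; exists 0.
exists (2 * C); first by rewrite mulr_ge0.
move=> y Ry; pose s := fix s k := if k is k'.+1 then s k' + g (y - f (s k')) else 0.
have rR k : range f (y - f (s k)) by apply: mem_subB => //; exists (s k).
have rk k : hnorm HW (y - f (s k)) <= hnorm HW y * half R k.
  elim: k => [|k IH]; first by rewrite /= (lin0 lf) subr0 /half expr0 mulr1.
  have [_] := gP _ (rR k); rewrite /= (linD lf) opprD addrA.
  by have := halfS R k; have := hnorm_ge0 HW y; nra.
have [|l sl] := @geometric_limit _ _ HV s (C * hnorm HW y).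
  move=> k /=; rewrite addrC addKr; have [h _] := gP _ (rR k).
  by apply: le_trans h _; rewrite -mulrA ler_wpM2l.
exists l; split; last first.
  by have := sl 0%N; rewrite /= sub0r hnormN /half expr0 mulr1 mulrA.
apply/eqP; rewrite -subr_eq0; apply/eqP/(@hnorm_eq0 _ _ HW)/eqP.
rewrite eq_le hnorm_ge0 andbT; apply: (@le_half0 _ _ (c * (2 * (C * hnorm HW y)) + hnorm HW y)) => k.
apply: le_trans (hnorm_trans HW _ (f (s k)) _) _.
rewrite -(linB lf) (hnormBC HW (f _)) mulrDl lerD //; apply: le_trans (fc _) _.
by rewrite -mulrA ler_wpM2l // hnormBC.
Qed.

(** The controlled preimage of [f x] differs from [x] by a kernel vector, orthogonal to [x], so by
    Pythagoras it is at least as long as [x]. *)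
Lemma bounded_below_orth_kernel : nclosed HW (range f) -> exists2 C, 0 <= C &
  forall x, orth HV (kernel f) x -> hnorm HV x <= C * hnorm HW (f x).
Proof.
move=> /open_mapping [C C0 h]; exists C => // x ox.
have [|x' [fx' x'C]] := h (f x); first by exists x.
apply: le_trans x'C; rewrite -(@ler_pXn2r _ 2) ?nnegrE ?hnorm_ge0 // !hnorm_sqr.
have [w -> xw] : exists2 w, x' = x + w & rip HV x w = 0.
  exists (x' - x); first by rewrite addrC subrK.
  by apply: ox; rewrite /kernel /= (linB lf) fx' subrr.
rewrite ripDl !ripDr (ripC HV w) xw.
by have := rip_ge0 HV w; lra.
Qed.

Lemma nclosed_kernel : nclosed HV (kernel f).
Proof.
move=> x h; apply: (@hnorm_eq0 _ _ HW); apply/eqP; rewrite eq_le hnorm_ge0 andbT.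
apply: (@le_half0 _ _ c) => k; have [y ky yx] := h _ (half_gt0 R k).
have -> : f x = - f (y - x) by rewrite (linB lf) ky sub0r opprK.
rewrite hnormN; apply: le_trans (fc _) _.
by rewrite ler_wpM2l // ltW.
Qed.

(** The lower bound pulls a convergent sequence of images back to a Cauchy sequence in [M]. *)
Lemma closed_image_bounded_below M C : subspace M -> nclosed HV M ->
  0 <= C -> (forall x, M x -> hnorm HV x <= C * hnorm HW (f x)) -> nclosed HW (f @` M).
Proof.
move=> sM cM C0 h y yM.
have /choice [u uP] : forall k, exists x, M x /\ hnorm HW (f x - y) < half R k.
  by move=> k; have [_ [x Mx <-] ?] := yM _ (half_gt0 R k); exists x.
have [|l ul] := @geometric_limit _ _ HV u (2 * C).
  move=> k; apply: le_trans (h _ _) _.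
    by apply: mem_subB => //; [case: (uP k.+1)|case: (uP k)].
  rewrite (mulrC 2) -mulrA ler_wpM2l // (linB lf).
  apply: le_trans (hnorm_trans HW _ y _) _; rewrite (hnormBC HW y).
  by have [_] := uP k; have [_] := uP k.+1; have := halfS R k; have := half_gt0 R k.+1; lra.
have Ml : M l.
  apply: cM => e e0; have [k ke] := half_small (2 * (2 * C)) e0; exists (u k).
    by case: (uP k).
  exact: le_lt_trans (ul k) ke.
exists l => //; apply/eqP; rewrite -subr_eq0; apply/eqP/(@hnorm_eq0 _ _ HW)/eqP.
rewrite eq_le hnorm_ge0 andbT; apply: (@le_half0 _ _ (c * (2 * (2 * C)) + 1)) => k.
apply: le_trans (hnorm_trans HW _ (f (u k)) _) _.
rewrite -(linB lf) mulrDl mul1r lerD //; last by apply: ltW; case: (uP k).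
by apply: le_trans (fc _) _; rewrite -mulrA ler_wpM2l // hnormBC.
Qed.

(** M + ker f is closed as a finite extension of [M]. By [open_mapping], a preimage [z] of a limit
    of points of f(M) is a limit of points of M + ker f. *)
Lemma closed_image_of_closed_range M k : nclosed HW (range f) ->
  reldim_le [set 0] (kernel f) k -> subspace M -> nclosed HV M -> nclosed HW (f @` M).
Proof.
move=> cR kfin sM cM y yM.
have sK := subspace_ker lf.
have cMK : nclosed HV (addset M (kernel f)).
  apply: (@closed_finite_ext _ _ HV M _ k) => //; first exact: subspace_add.
    exact: addsetL.
  move: kfin => [b bs]; exists b => _ [m Mm [z kz ->]].
  have [_ [d [-> zE]]] := bs _ kz; exists m, d; split=> //.
  by rewrite zE add0r.
have [C C0 hC] := open_mapping cR.
have [z _ fz] : range f y.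
  by apply: cR => e e0; have [_ [x Mx <-] ?] := yM e e0; exists (f x) => //; exists x.
suff [m Mm [w kw zE]] : addset M (kernel f) z.
  by exists m => //; rewrite -fz zE (linD lf) kw addr0.
apply: cMK => e e0.
(* Dividing by C + 1 covers the case C = 0. *)
have C1 : 0 < C + 1 by rewrite ltr_wpDl.
have [_ [m Mm <-] me] := yM (e / (C + 1)) (divr_gt0 e0 C1).
have [|x [fx xC]] := hC (f m - y).
  by apply: mem_subB; [exact: subspace_range|exists m|exists z].
(* f (z + x) = f m, so z + x is in m + ker f. *)
exists (z + x).
  exists m => //; exists (z + x - m); last by rewrite [RHS]addrC subrK.
  by rewrite /kernel /= (linB lf) (linD lf) fz fx (addrC y) subrK subrr.
rewrite addrC addKr; apply: le_lt_trans xC _.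
move: me; rewrite ltr_pdivlMr //; have := hnorm_ge0 HW (f m - y); nra.
Qed.

(** Subtracting the projection onto the kernel shows that a family spanning the kernel also spans
    modulo its orthogonal. *)
Lemma cofinite_orth_kernel k : reldim_le [set 0] (kernel f) k ->
  reldim_le (orth HV (kernel f)) setT k.
Proof.
move=> [b bs]; exists b => x _.
have [p kp op] := projection x (subspace_rsubspace (subspace_ker lf)) nclosed_kernel.
have [_ [d [-> pE]]] := bs _ kp; exists (x - p), d; split=> //.
by rewrite pE add0r subrK.
Qed.

End Operators.

(** * Topologies and Hilbert structures *)

Section Complex.
Variable R : realType.
Implicit Types z w : R[i].
Local Notation Re := complex.Re.
Local Notation "x %:C" := (x%:C%C).

Lemma ReD z w : Re (z + w) = Re z + Re w. Proof. by case: z w => [? ?] [? ?]. Qed.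
Lemma ReZ (t : R) z : Re (t%:C * z) = t * Re z.
Proof. by case: z => [a b] /=; rewrite mul0r subr0. Qed.
Lemma Re_conj z : Re (z^*) = Re z. Proof. by case: z. Qed.
Lemma ge0_Re z : 0 <= z -> z = (Re z)%:C /\ 0 <= Re z.
Proof. by case: z => a b; rewrite lecE /= => /andP[/eqP -> ?]. Qed.
Lemma mul_conj z : z * z^* = (Re z ^+ 2 + complex.Im z ^+ 2)%:C.
Proof. by rewrite -normCK normc_def -rmorphXn sqr_sqrtr // addr_ge0 // sqr_ge0. Qed.
Lemma ltC_R (s t : R) : (s%:C < t%:C) = (s < t). Proof. by rewrite ltcR. Qed.
End Complex.

Section InnerProduct.
Variables (R : realType) (V : completeNormedModType R[i]) (ip : V -> V -> R[i]).
Hypothesis hip : inner_product_of_norm ip.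
Local Notation "x %:C" := (x%:C%C).

Lemma norm_ReE (x : V) : `|x| = (complex.Re `|x|)%:C.
Proof. by case: (ge0_Re (normr_ge0 x)). Qed.

(** Take the real part of [ip]. The norm of [V] takes values in [R[i]] but is real, so Cauchy
    sequences and limits transfer through [Re]. *)
Lemma inner_product_hilb : exists H : hilb V, forall x, (hnorm H x)%:C = `|x|.
Proof.
case: hip => ipl ips ipn.
pose q x y := complex.Re (ip x y).
have ipD x y z : ip (x + y) z = ip x z + ip y z.
  by rewrite -{1}(scale1r x) ipl mul1r.
have ip0 z : ip 0 z = 0 by apply: (addrI (ip 0 z)); rewrite -ipD !addr0.
have ipZ a x z : ip (a *: x) z = a * ip x z by rewrite -[a *: x]addr0 ipl ip0 addr0.
have qD x y z : q (x + y) z = q x z + q y z by rewrite /q ipD ReD.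
have qC x y : q x y = q y x by rewrite /q ips Re_conj.
have qZ (t : R) x y : q (t%:C *: x) y = t * q x y by rewrite /q ipZ ReZ.
have qM a x y : q (a *: x) (a *: y) = (complex.Re a ^+ 2 + complex.Im a ^+ 2) * q x y.
  by rewrite /q ipZ ips ipZ rmorphM mulrA mul_conj ReZ (ips x y).
have qn x : q x x = (complex.Re `|x|) ^+ 2.
  by rewrite /q ipn norm_ReE -rmorphXn.
have n0 (x : V) : 0 <= complex.Re `|x| by case: (ge0_Re (normr_ge0 x)).
have nq x : Num.sqrt (q x x) = complex.Re `|x| by rewrite qn sqrtr_sqr ger0_norm.
have q0 x : 0 <= q x x by rewrite qn sqr_ge0.
have qe x : q x x = 0 -> x = 0.
  by move=> /eqP; rewrite qn sqrf_eq0 => /eqP E; apply/eqP; rewrite -normr_eq0 norm_ReE E.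
have qc (u : nat -> V) : (forall e : R, 0 < e -> exists n0, forall m n, (n0 <= m)%N -> (n0 <= n)%N ->
       Num.sqrt (q (u m - u n) (u m - u n)) < e) ->
    exists l, forall e : R, 0 < e -> exists n0, forall n, (n0 <= n)%N ->
       Num.sqrt (q (u n - l) (u n - l)) < e.
  move=> uc.
  have : cauchy (u @ \oo).
    apply: cauchy_exP => e e0; have [eE _] := ge0_Re (ltW e0).
    have e1 : 0 < complex.Re e by move: e0; rewrite eE ltC_R.
    have [N hN] := uc _ e1; exists (u N); exists N => // k Nk.
    by rewrite /= -ball_normE /= norm_ReE eE ltC_R -nq; exact: hN.
  move=> /cauchy_cvg /cvg_ex [l ul]; exists l => e e0.
  have e1 : 0 < e%:C by rewrite ltC_R.
  have /cvgrPdist_lt /(_ _ e1) [N _ hN] := ul.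
  exists N => n Nn; rewrite nq -ltC_R -norm_ReE distrC.
  exact: hN.
exists (Hilb qD qC qZ qM q0 qe qc) => x.
by rewrite /hnorm /= nq -norm_ReE.
Qed.

Lemma closed_nclosed (H : hilb V) : (forall x, (hnorm H x)%:C = `|x|) ->
  forall S : set V, closed S <-> nclosed H S.
Proof.
move=> HE S; split=> [cS x h|cS x h].
  apply: cS => B /nbhs_ballP [e /= e0 eB]; have [eE _] := ge0_Re (ltW e0).
  have e1 : 0 < complex.Re e by move: e0; rewrite eE ltC_R.
  have [y Sy yx] := h _ e1; exists y; split=> //; apply: eB.
  by rewrite -ball_normE /= eE -HE ltC_R hnormBC.
apply: cS => e e0.
have e1 : 0 < e%:C by rewrite ltC_R.
have [y [Sy]] := h _ (nbhsx_ballx x _ e1).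
rewrite -ball_normE /= -HE ltC_R hnormBC => yx.
by exists y.
Qed.
End InnerProduct.

Section DSumInjection.
Variables (K : numFieldType) (n : nat) (X : 'I_n -> preTopologicalLmodType K).
Local Notation V := (dsum X).

(** Since the type of a coordinate depends on its index, [x] must be cast along i = j; [dinj_same]
    removes the cast. *)
Definition dinj (i : 'I_n) (x : X i) : V :=
  fun j => if eqVneq i j is EqNotNeq e then ecast k (X k) e x else 0.

Lemma dinj_same i x : @dinj i x i = x.
Proof. by rewrite /dinj; case: eqVneq => [e|/eqP//]; rewrite eq_axiomK. Qed.
Lemma dinj_neq i j x : i != j -> @dinj i x j = 0.
Proof. by move=> ij; rewrite /dinj; case: eqVneq => // e; case: (negP ij); apply/eqP. Qed.
Lemma dsum_ext (x y : V) : (forall i, x i = y i) -> x = y.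
Proof. by move=> h; apply: functional_extensionality_dep. Qed.
Lemma linear_dinj i : linear_map (@dinj i).
Proof.
move=> a x y; apply: dsum_ext => j; change (dinj (a *: x + y) j = a *: dinj x j + dinj y j).
by case: (eqVneq i j) => [<-|ij]; rewrite ?dinj_same // !dinj_neq // scaler0 addr0.
Qed.
Lemma linear_proj i : linear_map (fun x : V => x i).
Proof. by []. Qed.

End DSumInjection.

Section DSumHilb.
Variables (R : realType) (n : nat) (X : 'I_n -> preTopologicalLmodType R[i]).
Variable H : forall i, hilb (X i).
Local Notation V := (dsum X).
Local Notation "x %:C" := (x%:C%C).

Definition drip (x y : V) : R := \sum_i rip (H i) (x i) (y i).

Lemma dripn_le i x : Num.sqrt (rip (H i) (x i) (x i)) <= Num.sqrt (drip x x).
Proof.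
apply: ler_wsqrtr; rewrite /drip (bigD1 i) //= lerDl.
by apply: sumr_ge0 => j _; exact: rip_ge0.
Qed.

Lemma drip_lt x e : 0 < e -> (forall i, hnorm (H i) (x i) < e / n.+1%:R) -> Num.sqrt (drip x x) < e.
Proof.
move=> e0 h; rewrite -(ger0_norm (ltW e0)) -sqrtr_sqr ltr_sqrt ?exprn_gt0 //.
have n0 : 0 < n.+1%:R :> R by rewrite ltr0n.
apply: (@le_lt_trans _ _ (\sum_(i < n) (e / n.+1%:R) ^+ 2)).
  apply: ler_sum => i _; rewrite -hnorm_sqr ler_pXn2r ?nnegrE ?hnorm_ge0 ?divr_ge0 ?ltW //.
(* The sum is n / (n + 1)^2 times e^2; the n.+1 gives strictness and allows n = 0. *)
rewrite sumr_const card_ord -[X in X < _]mulr_natl expr_div_n mulrCA gtr_pMr ?exprn_gt0 //.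
rewrite ltr_pdivrMr ?exprn_gt0 // mul1r -natrX ltr_nat.
by rewrite expnS expn1; apply: (@leq_trans n.+1) => //; rewrite leq_pmulr.
Qed.

Lemma dsum_hilb : exists D : hilb V, forall x y, rip D x y = drip x y.
Proof.
have qD x y z : drip (x + y) z = drip x z + drip y z.
  by rewrite /drip -big_split; apply: eq_bigr => i _; exact: ripDl.
have qC x y : drip x y = drip y x by apply: eq_bigr => i _; exact: ripC.
have qZ (t : R) x y : drip (t%:C *: x) y = t * drip x y.
  by rewrite /drip mulr_sumr; apply: eq_bigr => i _; exact: ripZl.
have qM a x y : drip (a *: x) (a *: y) = (complex.Re a ^+ 2 + complex.Im a ^+ 2) * drip x y.
  by rewrite /drip mulr_sumr; apply: eq_bigr => i _; exact: ripM.
have q0 x : 0 <= drip x x by apply: sumr_ge0 => i _; exact: rip_ge0.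
have qe x : drip x x = 0 -> x = 0.
  move=> E; apply: dsum_ext => i; apply: (@rip_eq0 _ _ (H i)); apply/eqP.
  have := dripn_le i x; rewrite E sqrtr0 -/(hnorm (H i) _) => h.
  by rewrite -hnorm_sqr sqrf_eq0 eq_le hnorm_ge0 andbT.
have qc (u : nat -> V) : (forall e : R, 0 < e -> exists n0, forall m n, (n0 <= m)%N -> (n0 <= n)%N ->
       Num.sqrt (drip (u m - u n) (u m - u n)) < e) ->
    exists l, forall e : R, 0 < e -> exists n0, forall n, (n0 <= n)%N ->
       Num.sqrt (drip (u n - l) (u n - l)) < e.
  move=> uc.
  have lim i : exists l, forall e : R, 0 < e -> exists n0, forall n, (n0 <= n)%N ->
       hnorm (H i) (u n i - l) < e.
    apply: rip_complete => e /uc [n0 h]; exists n0 => p q np nq.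
    exact: le_lt_trans (dripn_le i (u p - u q)) (h p q np nq).
  (* The limits live in different spaces [X i], hence [cid] instead of [choice]. *)
  pose l : V := fun i => projT1 (cid (lim i)).
  exists l => e e0.
  have e1 : 0 < e / n.+1%:R by rewrite divr_gt0 ?ltr0n.
  have /choice [N hN] : forall i, exists n0, forall k, (n0 <= k)%N -> hnorm (H i) (u k i - l i) < e / n.+1%:R.
    by move=> i; exact: (projT2 (cid (lim i)) _ e1).
  exists (\max_i N i)%N => k Nk; apply: drip_lt => // i; apply: hN.
  exact: leq_trans (leq_bigmax i) Nk.
by exists (Hilb qD qC qZ qM q0 qe qc).
Qed.

Variable D : hilb V.
Hypothesis DE : forall x y, rip D x y = drip x y.

Lemma hnorm_coord_le i x : hnorm (H i) (x i) <= hnorm D x.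
Proof. by rewrite {2}/hnorm DE; exact: dripn_le. Qed.
Lemma hnorm_dsum_lt x e : 0 < e -> (forall i, hnorm (H i) (x i) < e / n.+1%:R) -> hnorm D x < e.
Proof. by rewrite /hnorm DE; exact: drip_lt. Qed.

(** Norm balls at [x] form a filter converging in each coordinate, hence in the product topology;
    conversely, finitely many coordinate balls meet in a neighbourhood. *)
Lemma dsum_closed_nclosed :
  (forall i (S : set (X i)), closed S <-> nclosed (H i) S) ->
  forall S : set V, closed S <-> nclosed D S.
Proof.
move=> HX S; split=> [cS x h|cS x h].
  pose F : set_system V := [set B | exists2 e : R, 0 < e & [set y | hnorm D (y - x) < e] `<=` B].
  have FF : Filter F.
    split; first by exists 1.
      move=> P Q [e e0 eP] [d d0 dQ]; exists (Num.min e d); first by rewrite lt_min e0.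
      by move=> y /=; rewrite lt_min => /andP[? ?]; split; [exact: eP|exact: dQ].
    by move=> P Q PQ [e e0 eP]; exists e => // y /eP /PQ.
  have Fx : F --> (x : V).
    apply/cvg_sup => i A [_ [[G oG <-] Gx] GA].
    (* [HX] speaks of closed sets, so the ball inside [G] comes from norm closedness of its
       complement. *)
    have [e e0 eG] : exists2 e, 0 < e & forall y, hnorm (H i) (y - x i) < e -> G y.
      apply: contrapT => no; have := (HX i (~` G)).1 (open_closedC oG) (x i).
      apply; last exact: Gx.
      move=> e e0; apply: contrapT => h'; apply: no; exists e => // y yx.
      by apply: contrapT => Gy; apply: h'; exists y.
    exists e => // y yx; apply: GA; apply: eG.
    exact: le_lt_trans (hnorm_coord_le i (y - x)) yx.
  apply: cS => B /Fx [e e0 eB]; have [y Sy yx] := h _ e0.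
  by exists y; split=> //; apply: eB.
apply: cS => e e0.
have e1 : 0 < e / n.+1%:R by rewrite divr_gt0 ?ltr0n.
have nb i : nbhs x [set y : V | hnorm (H i) (y i - x i) < e / n.+1%:R].
  pose U := [set z : X i | hnorm (H i) (z - x i) < e / n.+1%:R].
  have oU : open U.
    rewrite -closedC; apply/HX => z hz /= zU; rewrite /U /= in zU.
    have [y yU yz] := hz _ (etrans (subr_gt0 _ _) zU); apply: yU => /=.
    by apply: le_lt_trans (hnorm_trans _ _ z _) _; rewrite -ltrBrDr.
  have /cvg_sup/(_ i) xi : nbhs x --> x by exact: cvg_id.
  apply: xi; exists [set y : V | U (y i)]; split=> //; first by exists U.
  by rewrite /U /= subrr hnorm0.
have : nbhs x [set y : V | forall i, hnorm (H i) (y i - x i) < e / n.+1%:R].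
  exact: filter_forall nb.
move=> /h [y [Sy yx]]; exists y => //; apply: hnorm_dsum_lt => // i.

Qed.
End DSumHilb.

(** * Triangular operators: indices *)

Section EnatSums.
Variable n : nat.
Implicit Types f : 'I_n -> enat.

Lemma esum_lt0 f : esum_lt f 0 = Some 0%N.
Proof. by rewrite /esum_lt big1. Qed.
Lemma esum_ltS f (k : 'I_n) : esum_lt f k.+1 = eadd (esum_lt f k) (f k).
Proof.
rewrite /esum_lt (bigD1 k) //= eaddC; congr eadd; apply: eq_bigl => s.
by rewrite ltnS ltn_neqAle andbC.
Qed.
Lemma esum_ltn f : esum_lt f n = esum_all f.
Proof. by apply: eq_bigl => s; rewrite ltn_ord. Qed.
Lemma esum_lt_fin f k : (forall s : 'I_n, (s < k)%N -> f s != einf) -> esum_lt f k != einf.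
Proof. by move=> h; apply: (big_ind (fun x => x != einf)) => // [[a|] [b|]]. Qed.

(** Pure arithmetic of the recursion that [fil_step] supplies for [fil_alpha] and [fil_beta]. *)
Variables (a b : nat -> enat) (al be : 'I_n -> enat).
Hypotheses (a0 : a 0 = Some 0%N) (b0 : b 0 = Some 0%N).
Hypothesis step : forall k : 'I_n, exists d,
  [/\ eadd (a k.+1) d = eadd (a k) (al k), eadd (b k.+1) d = eadd (b k) (be k),
      d != einf \/ al k = einf & d != einf \/ b k = einf].

(** Finite nullities force [d] to be finite at each step, so it can be cancelled. *)
Lemma index_le_all : (forall k, al k != einf) -> (forall k, ele (al k) (be k)) ->
  a n != einf /\ ele (a n) (b n).
Proof.
move=> alf albe.
suff : forall k, (k <= n)%N -> a k != einf /\ ele (a k) (b k) by apply.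
elim=> [|k IH] kn; first by rewrite a0 b0.
have [d [E1 E2 _ _]] := step (Ordinal kn).
move: E1 E2 (alf (Ordinal kn)) (albe (Ordinal kn)) (IH (ltnW kn)) => /=.
case: (al _) => [x|] //; case: (a k) => [u|]; last by move=> ? ? ? ? [].
case: (a k.+1) d => [p|] [d|] //= [E1] E2 _ h2 [_ h1]; split=> //.
case: (b k.+1) E2 => [q|//]; case: (b k) h1 => [v|//]; case: (be _) h2 => [y|//] /=.
by move=> h1 h2 [E2]; lia.
Qed.

(** Additivity of the index, written without subtraction; it needs finite defects, whereas
    finiteness of [a k] does not. *)
Lemma index_sum k : (k <= n)%N -> (forall s : 'I_n, (s < k)%N -> al s != einf) ->
  a k != einf /\ (esum_lt be k != einf ->
    b k != einf /\ eadd (esum_lt al k) (b k) = eadd (esum_lt be k) (a k)).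
Proof.
elim: k => [|k IH] kn alf; first by rewrite a0 b0 !esum_lt0.
have [afin bfin] := IH (ltnW kn) (fun s sk => alf s (ltnW sk)).
have [d [E1 E2 _ _]] := step (Ordinal kn).
have ES f : esum_lt f k.+1 = eadd (esum_lt f k) (f (Ordinal kn)) by exact: (esum_ltS f (Ordinal kn)).
rewrite !ES.
move: E1 E2 (alf (Ordinal kn) (ltnSn k)) (esum_lt_fin (fun s sk => alf s (ltnW sk))) => /=.
case: (al _) => [x|] //; case: (a k) afin bfin => [u|] // _ bfin.
case: (a k.+1) d => [p|] [d|] //= [E1] E2 _; case: (esum_lt al k) bfin => [S|] // bfin _; split=> //.
case: (esum_lt be k) bfin => [S'|] //; case: (be _) E2 => [y|] // E2 /(_ isT) [].
case: (b k) E2 => [v|] //; case: (b k.+1) => [q|] //= [E2] _ [E3] _.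
by split=> //; congr Some; lia.
Qed.

Lemma le_esum_of_index_le : (forall k, al k != einf) -> ele (a n) (b n) ->
  ele (esum_all al) (esum_all be).
Proof.
move=> alf; have [] := index_sum (leqnn n) (fun s _ => alf s); rewrite !esum_ltn.
have : esum_all al != einf by rewrite -esum_ltn; apply: esum_lt_fin.
case: (esum_all al) => [S|] // _; case: (esum_all be) => [S'|] //.
case: (a n) => [u|] // _ /(_ isT) []; case: (b n) => [v|] //= _ [E] uv; lia.
Qed.

(** Finite earlier defects make [b k] finite, hence [d] finite; the infinite nullity must then sit
    in [a k.+1]. *)
Lemma first_infinite (k : 'I_n) : (forall s : 'I_n, (s < k)%N -> al s != einf) ->
  al k = einf -> esum_lt be k != einf -> a k.+1 = einf.
Proof.
move=> alf ak bek; have [afin /(_ bek) [bfin _]] := index_sum (ltnW (ltn_ord k)) alf.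
have [d [E _ _ [|/eqP]]] := step k; last by rewrite (negPf bfin).
rewrite ak in E; case: d E => [d|] //; case: (a k) => [?|]; by case: (a k.+1).
Qed.

End EnatSums.

Section Filtration.
Variables (K : numFieldType) (n : nat) (X : 'I_n -> preTopologicalLmodType K).
Local Notation V := (dsum X).
Variables (t : forall k, X k -> X k) (A : forall i j : 'I_n, X j -> X i) (T : V -> V).
(** An equation rather than a definition, since it will be applied both to the operator matrix and
    to that matrix minus a scalar. *)
Hypothesis TE : forall x i, T x i = t (x i) + \sum_(j < n | (i < j)%N) A i (x j).
Hypothesis lt_ : forall k, linear_map (@t k).
Hypothesis lA : forall i j : 'I_n, (i < j)%N -> linear_map (@A i j).

Lemma linear_tri : linear_map T.
Proof.
move=> a x y; apply: dsum_ext => i; change (T (a *: x + y) i = a *: T x i + T y i).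
rewrite !TE scalerDr scaler_sumr addrACA -big_split lt_; congr (_ + _).
by apply: eq_bigr => j ij; exact: lA.
Qed.

Definition fil (k : nat) : set V := [set x | forall i : 'I_n, (k <= i)%N -> x i = 0].

Lemma subspace_fil k : subspace (fil k).
Proof.
split=> [//|a x y fx fy i ki]; change (a *: x i + y i = 0).
by rewrite fx // fy // scaler0 addr0.
Qed.
Lemma filS k : fil k `<=` fil k.+1.
Proof. by move=> x fx i /ltnW; exact: fx. Qed.
Lemma fil0 : fil 0 = [set 0].
Proof. by apply/seteqP; split=> [x fx|x ->] //; apply: dsum_ext => i; exact: fx. Qed.
Lemma filn : fil n = setT.
Proof. by apply/seteqP; split=> // x _ i; rewrite leqNgt ltn_ord. Qed.
Lemma fil_dinj (k : 'I_n) (x : X k) : fil k.+1 (dinj x).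
Proof. by move=> i ki; rewrite dinj_neq //; apply/eqP => E; move: ki; rewrite E ltnn. Qed.

(** The off-diagonal terms involve only coordinates j > i >= k, where [x] vanishes. *)
Lemma tri_fil_top k x (i : 'I_n) : fil k.+1 x -> (k <= i)%N -> T x i = t (x i).
Proof.
move=> fx ki; rewrite TE big1 ?addr0 // => j ij.
by rewrite fx ?(lin0 (lA ij)) // (leq_ltn_trans ki).
Qed.
Lemma tri_fil k x : fil k x -> fil k (T x).
Proof.
move=> fx i ki; rewrite (@tri_fil_top k) //; last exact: filS.
by rewrite fx // (lin0 (@lt_ i)).
Qed.

(** Projection to coordinate [k] identifies fil (k+1) / fil k with [X k], and the map induced by [T]
    with [t k]; this compares the kernels. *)
Lemma reldim_tri_kernel (k : 'I_n) :
  reldim (fil k) [set x | fil k.+1 x /\ fil k (T x)] = alpha (@t k).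
Proof.
rewrite /alpha dimensionE; have lT := linear_tri; apply: (reldim_iso (linear_proj k)).
- exact: subspace_fil.
- by apply: subspaceI; [exact: subspace_fil|apply: subspace_preimage => //; exact: subspace_fil].
- exact: subspace0.
- by move=> x ->; exact: (lin0 (@lt_ k)).
- by move=> x [fx /(_ k (leqnn k))]; rewrite (@tri_fil_top k).
- move=> y ky; exists (dinj y); last by rewrite dinj_same subrr.
  split; first exact: fil_dinj.
  move=> i; rewrite leq_eqVlt => /predU1P[/val_inj <-|ki].
    by rewrite (@tri_fil_top k) ?dinj_same //; exact: fil_dinj.
  by apply: tri_fil ki; exact: fil_dinj.
- move=> x [fx _]; split=> [x0 i|fx']; last exact: fx'.
  by rewrite leq_eqVlt => /predU1P[/val_inj <- //|]; exact: fx.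
Qed.

(** The same identification, for cokernels. *)
Lemma reldim_tri_range (k : 'I_n) :
  reldim (addset (fil k) (T @` fil k.+1)) (fil k.+1) = beta (@t k).
Proof.
rewrite /beta codimensionE; have lT := linear_tri.
have sI := subspace_image lT (subspace_fil k.+1).
apply: (reldim_iso (linear_proj k)) => //.
- by apply: subspace_add => //; exact: subspace_fil.
- exact: subspace_fil.
- exact: subspace_range.
- move=> y _; exists (dinj y); first exact: fil_dinj.
  by rewrite dinj_same subrr; apply: (mem_sub0 (subspace_range (@lt_ k))).
move=> x fx; split=> [[y _ yx]|[u fu [_ [v fv <-] ->]]]; last first.
  by exists (v k) => //; change (t (v k) = u k + T v k); rewrite fu // add0r (@tri_fil_top k).
exists (x - T (dinj y)); last first.
  by exists (T (dinj y)); [exists (dinj y) => //; exact: fil_dinj|rewrite subrK].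
move=> i; change ((k <= i)%N -> x i - T (dinj y) i = 0).
rewrite leq_eqVlt => /predU1P[/val_inj <-|ki].
  by rewrite (@tri_fil_top k) ?dinj_same ?yx ?subrr //; exact: fil_dinj.
by rewrite fx // (tri_fil (@fil_dinj k y)) // subrr.
Qed.

Definition fil_alpha k := reldim [set 0] (kernel T `&` fil k).
Definition fil_beta k := reldim (T @` fil k) (fil k).

Lemma reldim_refl (W : lmodType K) (B : set W) : subspace B -> reldim B B = Some 0%N.
Proof.
move=> sB; apply: (@basis_reldim _ _ _ _ _ (fun=> 0)) => //; split=> [[]//|c _ []//|v Bv].
by exists v, (fun=> 0); split=> //; rewrite /lcomb big_ord0 addr0.
Qed.

Lemma fil_alpha0 : fil_alpha 0 = Some 0%N.
Proof.
have -> : fil_alpha 0 = reldim [set (0 : V)] [set 0].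
  congr reldim; rewrite fil0; apply/seteqP; split=> [x []|x ->] //.
  by split=> //; exact: (lin0 linear_tri).
by apply: reldim_refl; exact: subspace0.
Qed.
Lemma fil_beta0 : fil_beta 0 = Some 0%N.
Proof.
have -> : fil_beta 0 = reldim [set (0 : V)] [set 0].
  rewrite /fil_beta fil0; congr reldim; apply/seteqP; split=> [_ [x -> <-]|x ->].
    exact: (lin0 linear_tri).
  by exists 0 => //; exact: (lin0 linear_tri).
by apply: reldim_refl; exact: subspace0.
Qed.
Lemma fil_alphan : fil_alpha n = alpha T.
Proof. by rewrite /fil_alpha filn setIT /alpha dimensionE. Qed.
Lemma fil_betan : fil_beta n = beta T.
Proof. by rewrite /fil_beta filn /beta codimensionE. Qed.

Lemma fil_step (k : 'I_n) : exists d,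
  [/\ eadd (fil_alpha k.+1) d = eadd (fil_alpha k) (alpha (@t k)),
      eadd (fil_beta k.+1) d = eadd (fil_beta k) (beta (@t k)),
      d != einf \/ alpha (@t k) = einf & d != einf \/ fil_beta k = einf].
Proof.
rewrite -reldim_tri_kernel -reldim_tri_range; apply: snake.
- exact: linear_tri.
- exact: subspace_fil.
- exact: subspace_fil.
- exact: filS.
- by move=> _ [x fx <-]; exact: tri_fil.
- by move=> _ [x fx <-]; exact: tri_fil.
Qed.

Lemma fil_alpha_fin k : alpha T != einf -> fil_alpha k != einf.
Proof.
rewrite /alpha dimensionE => /reldim_fin [m h]; apply/reldim_fin; exists m.
by apply: reldim_leW h => // x [].
Qed.
End Filtration.

(** * Triangular operators: closed ranges *)

Lemma alpha_finP (K : numFieldType) (V W : lmodType K) (f : V -> W) :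
  alpha f != einf <-> exists k, reldim_le [set 0] (kernel f) k.
Proof. by rewrite /alpha dimensionE; exact: reldim_fin. Qed.

Section LeftFredholm.
Variables (R : realType) (V : preTopologicalLmodType R[i]) (H : hilb V).
Hypothesis HV : forall S : set V, closed S <-> nclosed H S.

(** The orthogonal of a closed range is a closed complement. *)
Lemma left_fredholmP (f : V -> V) : linear_map f ->
  left_fredholm f <-> alpha f != einf /\ nclosed H (range f).
Proof.
move=> lf; have sR := subspace_range lf; split=> [[fa [/HV fc _]]|[fa fc]] //.
split=> //; split; first exact/HV.
exists (orth H (range f)); split; first exact: orth_sub.
split; first by apply/HV; exact: orth_closed.
split.
  apply/seteqP; split=> [x [Rx ox]|x ->]; first exact: (orth_cap Rx ox).
  by split; [exact: (mem_sub0 sR)|move=> z _; exact: rip0l].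
move=> v; have [m Rm om] := projection v (subspace_rsubspace sR) fc.
by exists m, (v - m); rewrite [RHS]addrC subrK.
Qed.
End LeftFredholm.

Definition hbounded (R : realType) (V W : lmodType R[i]) (HV : hilb V) (HW : hilb W) (f : V -> W) :=
  exists2 c : R, 0 <= c & forall x, hnorm HW (f x) <= c * hnorm HV x.

Section Triangular.
Variables (R : realType) (n : nat) (X : 'I_n -> preTopologicalLmodType R[i]).
Variable H : forall i, hilb (X i).
Local Notation V := (dsum X).
Variable D : hilb V.
Hypothesis DE : forall x y, rip D x y = drip H x y.
Variables (t : forall k, X k -> X k) (A : forall i j : 'I_n, X j -> X i) (T : V -> V).
Hypothesis TE : forall x i, T x i = t (x i) + \sum_(j < n | (i < j)%N) A i (x j).
Hypothesis lt_ : forall k, linear_map (@t k).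
Hypothesis lA : forall i j : 'I_n, (i < j)%N -> linear_map (@A i j).
Hypothesis bt : forall k, hbounded (H k) (H k) (@t k).
Hypothesis bA : forall i j : 'I_n, (i < j)%N -> hbounded (H j) (H i) (@A i j).

Let lT : linear_map T := linear_tri TE lt_ lA.

Lemma hnorm_sum (W : lmodType R[i]) (HW : hilb W) (I : finType) (P : pred I) (F : I -> W) :
  hnorm HW (\sum_(i | P i) F i) <= \sum_(i | P i) hnorm HW (F i).
Proof.
elim/big_ind2 : _ => [|x a y b xa yb|//]; first by rewrite hnorm0.
exact: le_trans (hnormD _ _ _) (lerD xa yb).
Qed.

Lemma hnorm_dsum_le x B : (forall i, hnorm (H i) (x i) <= B) -> 0 <= B -> hnorm D x <= n.+1%:R * B.
Proof.
move=> h B0; apply/ler_addgt0Pr => e e0; apply/ltW/(hnorm_dsum_lt DE) => [|i].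
  by rewrite ltr_wpDl // mulr_ge0.
rewrite mulrDl mulrAC divff ?pnatr_eq0 // mul1r.
by apply: le_lt_trans (h i) _; rewrite ltrDl divr_gt0 // ltr0n.
Qed.

Lemma hnorm_dinj i (x : X i) : hnorm D (dinj x) = hnorm (H i) x.
Proof.
rewrite /hnorm DE /drip (bigD1 i) //= dinj_same big1 ?addr0 // => j ji.
by rewrite dinj_neq 1?eq_sym // rip0l.
Qed.

(** Pairs with i >= j get the constant 0, so that the constants can be summed over all indices. *)
Lemma bounded_offdiag : exists a : 'I_n -> 'I_n -> R, forall i j,
  0 <= a i j /\ ((i < j)%N -> forall x, hnorm (H i) (A i x) <= a i j * hnorm (H j) x).
Proof.
have /choice [a aP] : forall p : 'I_n * 'I_n, exists c : R,
    0 <= c /\ ((p.1 < p.2)%N -> forall x, hnorm (H p.1) (A p.1 x) <= c * hnorm (H p.2) x).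
  move=> [i j] /=; case: (boolP (i < j)%N) => ij; last by exists 0.
  by have [c c0 h] := bA ij; exists c.
by exists (fun i j => a (i, j)) => i j; exact: (aP (i, j)).
Qed.

Lemma bounded_tri : hbounded D D T.
Proof.
have [a aP] := bounded_offdiag.
have /choice [c cP] : forall i, exists c : R, 0 <= c /\ forall x, hnorm (H i) (t x) <= c * hnorm (H i) x.
  by move=> i; have [c c0 h] := bt i; exists c.
pose B := \sum_i (c i + \sum_j a i j).
have S0 i : 0 <= \sum_j a i j by apply: sumr_ge0 => j _; case: (aP i j).
have C0 i : 0 <= c i + \sum_j a i j by rewrite addr_ge0 //; case: (cP i).
exists (n.+1%:R * B); first by rewrite mulr_ge0 // sumr_ge0.
move=> x; rewrite -mulrA; apply: hnorm_dsum_le; last by rewrite mulr_ge0 ?sumr_ge0 ?hnorm_ge0.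
move=> i; apply: (@le_trans _ _ ((c i + \sum_j a i j) * hnorm D x)); last first.
  by rewrite ler_wpM2r ?hnorm_ge0 // /B [leRHS](bigD1 i) //= lerDl sumr_ge0.
rewrite TE mulrDl; apply: le_trans (hnormD _ _ _) _; apply: lerD.
  have [c0 h] := cP i; apply: le_trans (h _) _.
  by rewrite ler_wpM2l // hnorm_coord_le.
apply: le_trans (hnorm_sum _ _ _) _; rewrite mulr_suml.
rewrite [leRHS](bigID (fun j : 'I_n => (i < j)%N)) /=.
apply: ler_wpDr; first by apply: sumr_ge0 => j _; rewrite mulr_ge0 ?hnorm_ge0 //; case: (aP i j).
apply: ler_sum => j ij; have [a0 h] := aP i j; apply: le_trans (h ij _) _.
by rewrite ler_wpM2l // hnorm_coord_le.
Qed.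

(* [T] is bounded below on the finite-codimensional subspace of vectors with coordinates orthogonal to the kernels of the diagonal entries: solve from the last coordinate upwards. *)
Lemma closed_range_tri : (forall k, alpha (@t k) != einf) ->
  (forall k, nclosed (H k) (range (@t k))) -> nclosed D (range T).
Proof.
move=> alf clo; have [cT cT0 hT] := bounded_tri.
(* Constraining only the first [m] coordinates lets the codimension of [Mk n] be counted one
   coordinate at a time. *)
pose Mk (m : nat) : set V := [set x | forall i : 'I_n, (i < m)%N -> orth (H i) (kernel (@t i)) (x i)].
have so i : subspace (orth (H i) (kernel (@t i))) by apply: orth_sub; exact: subspace_ker.
have sM m : subspace (Mk m).
  split=> [i _|b x y Mx My i im]; first exact: (mem_sub0 (so i)).
  by apply: (so i).2; [exact: Mx|exact: My].
have cM m : nclosed D (Mk m).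
  move=> x h i im; apply: orth_closed => e /h [y My yx].
  by exists (y i); [exact: My|exact: le_lt_trans (hnorm_coord_le DE i (y - x)) yx].
have [N fM] : exists N, reldim_le (Mk n) setT N.
  suff : forall m, (m <= n)%N -> exists N, reldim_le (Mk m) setT N by apply.
  elim=> [|m IH] mn; first by exists 0%N, (fun=> 0) => v _; exists v, (fun=> 0); rewrite /lcomb big_ord0 addr0.
  have [N hN] := IH (ltnW mn); pose i0 := Ordinal mn.
  have [k hk] := (alpha_finP _).1 (alf i0).
  have [c c0 hc] := bt i0.
  have [b bs] := cofinite_orth_kernel (@lt_ i0) c0 hc hk.
  exists (k + N)%N; apply: reldim_le_trans hN.
  exists (fun j => dinj (b j)) => v Mv; have [u [d [ou uE]]] := bs (v i0) I.
  exists (v - dinj (lcomb b d)), d; split; last first.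
    by rewrite (lin_lcomb (@linear_dinj _ _ X i0)) subrK.
  have E j : (v - dinj (lcomb b d)) j = v j - dinj (lcomb b d) j by [].
  move=> i; rewrite ltnS leq_eqVlt E => /predU1P[im|im].
    have -> : i = i0 by exact: val_inj.
    by rewrite dinj_same uE addrK.
  rewrite dinj_neq ?subr0; first exact: Mv.
  by rewrite -val_eqE /= gtn_eqF.
have [a aP] := bounded_offdiag.
have bb : forall m, (m <= n)%N -> exists2 C, 0 <= C & forall i : 'I_n, (n - m <= i)%N ->
    forall x, Mk n x -> hnorm (H i) (x i) <= C * hnorm D (T x).
  elim=> [|m IH] mn; first by exists 0 => // i; rewrite subn0 leqNgt ltn_ord.
  have [C C0 hC] := IH (ltnW mn).
  have kn : (n - m.+1 < n)%N by lia.
  pose k := Ordinal kn; have [c c0 hc] := bt k.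
  have [ck ck0 hck] := bounded_below_orth_kernel (@lt_ k) c0 hc (@clo k).
  have S0 : 0 <= \sum_j a k j * C by apply: sumr_ge0 => j _; rewrite mulr_ge0 //; case: (aP k j).
  (* [C] serves the coordinates already treated; the other term bounds coordinate [k], as t (x k) is
     T x k minus terms in later coordinates. *)
  exists (C + ck * (1 + \sum_j a k j * C)); first by rewrite addr_ge0 // mulr_ge0 // addr_ge0.
  move=> i ni x Mx; rewrite mulrDl.
  have [ik|ik] := eqVneq i k; last first.
    apply: ler_wpDr; first by rewrite !mulr_ge0 ?hnorm_ge0 ?addr_ge0.
    apply: hC => //; move: ik; rewrite -val_eqE /=; lia.
  rewrite ik; apply: ler_wpDl; first by rewrite mulr_ge0 ?hnorm_ge0.
  apply: le_trans (hck _ (Mx k (ltn_ord k))) _; rewrite -mulrA ler_wpM2l // mulrDl mul1r.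
  have -> : t (x k) = T x k - \sum_(j < n | (k < j)%N) A k (x j) by rewrite TE addrK.
  apply: le_trans (hnormB _ _ _) _; apply: lerD; first exact: hnorm_coord_le.
  apply: le_trans (hnorm_sum _ _ _) _; rewrite mulr_suml.
  rewrite [leRHS](bigID (fun j : 'I_n => (k < j)%N)) /=.
  apply: ler_wpDr; first by apply: sumr_ge0 => j _; rewrite !mulr_ge0 ?hnorm_ge0 //; case: (aP k j).
  apply: ler_sum => j kj; have [a0 h] := aP k j; apply: le_trans (h kj _) _.
  rewrite -mulrA ler_wpM2l //; apply: hC => //; move: kj => /=; lia.
have [C C0 hC] := bb n (leqnn n).
apply: (@closed_finite_ext _ _ D (T @` Mk n) _ N).
- exact: subspace_image.
- apply: (closed_image_bounded_below lT cT0 hT (C := n.+1%:R * C)) => //.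
    by rewrite mulr_ge0.
  move=> x Mx; rewrite -mulrA; apply: hnorm_dsum_le; last by rewrite mulr_ge0 ?hnorm_ge0.
  by move=> i; apply: hC => //; rewrite subnn.
- exact: subspace_range.
- by move=> _ [x _ <-]; exists x.
- exact: reldim_le_image.
Qed.

(** [T] acts on the first summand [fil 1] as [t k], and [closed_image_of_closed_range] makes the
    image of this closed subspace closed. *)
Lemma closed_range_first (k : 'I_n) : (k : nat) = 0%N -> alpha T != einf ->
  nclosed D (range T) -> nclosed (H k) (range (@t k)).
Proof.
move=> k0 /alpha_finP [m hm] cT; have [c c0 hc] := bounded_tri.
have cF : nclosed D (@fil _ _ X 1).
  move=> x h i i1; apply: (@hnorm_eq0 _ _ (H i)); apply/eqP; rewrite eq_le hnorm_ge0 andbT.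
  apply/ler_addgt0Pr => e e0; rewrite add0r; have [y fy yx] := h _ e0.
  apply: le_trans (ltW yx); apply: le_trans (hnorm_coord_le DE i (y - x)).
  have -> : (y - x) i = y i - x i by [].
  by rewrite fy // sub0r hnormN.
have fE (x : X k) : fil 1 (dinj x) by have := fil_dinj x; rewrite k0.
have TdE (x : X k) : T (dinj x) = dinj (t x).
  apply: dsum_ext => i; rewrite (tri_fil_top TE lA (k := 0%N)) //.
  have [<-|ki] := eqVneq k i; first by rewrite !dinj_same.
  by rewrite !dinj_neq // (lin0 (@lt_ i)).
have cTF := closed_image_of_closed_range lT c0 hc cT hm (@subspace_fil _ _ X 1) cF.
move=> y h; have [e e0|z fz /(congr1 (fun u => u k)) E] := cTF (dinj y).
  have [_ [x _ <-] xy] := h e e0; exists (dinj (t x)).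
    by exists (dinj x); rewrite ?TdE.
  by rewrite -(linB (@linear_dinj _ _ X k)) hnorm_dinj.
exists (z k) => //; rewrite dinj_same in E; rewrite -E.
by rewrite (tri_fil_top TE lA (k := 0%N)).
Qed.
End Triangular.

(** * The spectra *)

Lemma not_elt_ele a b : ~ elt b a -> ele a b.
Proof.
move=> /negP; rewrite /elt negb_and negbK.
case: a b => [x|] [y|] //=; rewrite -?ltnNge => /orP[|/eqP //]; first exact: ltnW.
by case=> ->.
Qed.

Lemma esum_lt_inf n (f : 'I_n -> enat) k : esum_lt f k = einf -> esum_all f = einf.
Proof.
move=> fk; apply/eqP; apply: contraT => fa.
suff : esum_lt f k != einf by rewrite fk.
apply: esum_lt_fin => s _; apply: contraNN fa => /eqP fs.
by rewrite /esum_all (bigD1 s) //= fs.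
Qed.

Section Subl.
Variables (K : numFieldType) (V : preTopologicalLmodType K) (f : V -> V) (l : K).
Hypothesis lf : linear_map f.

Lemma linear_subl : linear_map (subl f l).
Proof.
move=> a x y; rewrite /subl lf scalerBr scalerDr !scalerA (mulrC l) opprD.
by rewrite addrACA.
Qed.

(** The spectra are defined by l - D and the Delta sets by D - l; the sign changes neither kernel
    nor range. *)
Lemma lsubE x : lsub l f x = - subl f l x.
Proof. by rewrite /lsub /subl opprB. Qed.

Lemma kernel_lsub : kernel (lsub l f) = kernel (subl f l).
Proof.
apply/seteqP; split=> x; rewrite /kernel /= lsubE.
  by move/eqP; rewrite oppr_eq0 => /eqP.
by move=> ->; rewrite oppr0.
Qed.

Lemma range_lsub : range (lsub l f) = range (subl f l).
Proof.
apply/seteqP; split=> _ [x _ <-]; exists (- x) => //.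
  by rewrite (linN linear_subl) lsubE.
by rewrite lsubE (linN linear_subl) opprK.
Qed.

Lemma left_fredholm_lsub : left_fredholm (lsub l f) = left_fredholm (subl f l).
Proof. by rewrite /left_fredholm /alpha kernel_lsub range_lsub. Qed.

Lemma left_weyl_lsub : left_weyl (lsub l f) = left_weyl (subl f l).
Proof. by rewrite /left_weyl left_fredholm_lsub /alpha /beta kernel_lsub range_lsub. Qed.
End Subl.

Section Bounded.
Variable R : realType.

Lemma bounded_op_hbounded (V W : normedModType R[i]) (HV : hilb V) (HW : hilb W) (f : V -> W) :
  (forall x, (hnorm HV x)%:C%C = `|x|) -> (forall x, (hnorm HW x)%:C%C = `|x|) ->
  bounded_op f -> hbounded HV HW f.
Proof.
move=> EV EW [_ [M fM]]; have [ME M0] := ge0_Re (normr_ge0 M).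
(* [M] is a scalar of [R[i]], so its modulus is taken; M |x| dominates a norm, hence equals its own
   modulus. *)
exists (complex.Re `|M|) => // x; rewrite -lecR rmorphM /= -ME EV EW.
apply: le_trans (fM x) _; rewrite -{2}(normr_id x) -normrM ger0_norm //.
exact: le_trans (normr_ge0 _) (fM x).
Qed.

Lemma hbounded_subl (V : lmodType R[i]) (H : hilb V) (f : V -> V) l :
  hbounded H H f -> hbounded H H (subl f l).
Proof.
move=> [c c0 h]; eexists; last first.
  move=> x; apply: le_trans (hnormB _ _ _) _; rewrite hnormM.
  by apply: le_trans (lerD (h x) (lexx _)) _; rewrite -mulrDl.
by rewrite addr_ge0 // sqrtr_ge0.
Qed.
End Bounded.

Theorem mainTheorem1 (R : realType) (n : nat) (hn : (2 <= n)%N)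
  (X : 'I_n -> completeNormedModType R[i])
  (ip : forall k : 'I_n, X k -> X k -> R[i])
  (hHilbert : forall k : 'I_n, inner_product_of_norm (ip k))
  (hinf : forall k : 'I_n, infinite_dim (X k))
  (D : forall k : 'I_n, X k -> X k)
  (hD : forall k : 'I_n, bounded_op (D k))
  (A : forall i j : 'I_n, X j -> X i)
  (hA : forall i j : 'I_n, (i < j)%N -> bounded_op (A i j)) :
  \bigcup_(k in [set: 'I_n])
     sigma_lw (D k : (X k : preTopologicalLmodType R[i]) -> X k)
  = sigma_lw (upper_tri (X := fun k => X k : normedModType R[i]) D A)
    `|` Delta1 (X := fun k => X k : normedModType R[i]) D
    `|` Delta2 (X := fun k => X k : normedModType R[i]) D.
Proof.
pose Y (k : 'I_n) : preTopologicalLmodType R[i] := X k.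
pose hk k := cid (inner_product_hilb (hHilbert k)).
pose H k : hilb (Y k) := projT1 (hk k).
have HE k x : (hnorm (H k) x)%:C%C = `|x : X k| by exact: (projT2 (hk k) x).
have HC k (S : set (Y k)) : closed S <-> nclosed (H k) S by exact: closed_nclosed (HE k) S.
have [E EE] := dsum_hilb H.
have EC (S : set (dsum Y)) : closed S <-> nclosed E S by exact: dsum_closed_nclosed EE HC S.
have bD k : hbounded (H k) (H k) (D k) by exact: (bounded_op_hbounded (HE k) (HE k) (hD k)).
have bA (i j : 'I_n) : (i < j)%N -> hbounded (H j) (H i) (A i j).
  by move=> ij; exact: (bounded_op_hbounded (HE j) (HE i) (hA _ _ ij)).
have lD k : linear_map (D k : Y k -> Y k) by case: (hD k).
have lA (i j : 'I_n) : (i < j)%N -> linear_map (A i j : Y j -> Y i) by move=> /hA [].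
pose U : dsum Y -> dsum Y := upper_tri (X := fun k => X k : normedModType R[i]) D A.
have lU : linear_map U by apply: (linear_tri (t := D) (A := A)).
apply/funext => l; apply/propext.
pose t k : Y k -> Y k := subl (D k : Y k -> Y k) l.
pose T : dsum Y -> dsum Y := subl U l.
have lt_ k : linear_map (t k) by apply: linear_subl.
have bt k : hbounded (H k) (H k) (t k) by apply: hbounded_subl.
have TE x i : T x i = t i (x i) + \sum_(j < n | (i < j)%N) A i j (x j).
  by rewrite -[T x i]/(U x i - l *: x i) /U /upper_tri addrAC.
have lT := linear_tri TE lt_ lA.
have wk k : sigma_lw (D k : Y k -> Y k) l = ~ left_weyl (t k).
  by rewrite /sigma_lw /= (left_weyl_lsub l (@lD k)).
have wT : sigma_lw U l = ~ left_weyl T by rewrite /sigma_lw /= (left_weyl_lsub l lU).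
have fk k := left_fredholmP (@HC k) (lt_ k).
have fT := left_fredholmP EC lT.
have st := fil_step TE lt_ lA.
have a0 := fil_alpha0 TE lt_ lA.
have b0 := fil_beta0 TE lt_ lA.
split.
  move=> [k _]; rewrite wk => nW; apply: contrapT => no.
  have [lwT nD1 nD2] : [/\ left_weyl T, ~ Delta1 (X := fun k => X k : normedModType R[i]) D l
      & ~ Delta2 (X := fun k => X k : normedModType R[i]) D l].
    split; [|by move=> h; apply: no; left; right|by move=> h; apply: no; right].
    by apply: contrapT => h; apply: no; left; left; rewrite wT.
  have [/fT [aT cT] abT] := lwT.
  (* With all nullities finite, any failure of [t k] to be left Weyl puts [l] in [Delta2]; otherwise
     the first infinite nullity puts it in [Delta1]. *)
  have [[k0 k0inf]|fin] := pselect (exists k, alpha (t k) = einf); last first.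
    have {}fin s : alpha (t s) != einf by apply/eqP => h; apply: fin; exists s.
    apply: nW; split; last first.
      apply: not_elt_ele => h; apply: nD2; exists k => //; split=> //; split; last by left.
      apply: (le_esum_of_index_le a0 b0 st fin).
      by rewrite fil_alphan fil_betan.
    apply/fk; split=> //; apply/HC; apply: contrapT => h; apply: nD2; exists k => //.
    split=> //; split; last by right.
    apply: (le_esum_of_index_le a0 b0 st fin).
    by rewrite fil_alphan fil_betan.
  have [m /eqP minf mmin] := @arg_minnP _ k0 (fun k => alpha (t k) == einf) (fun k => k : nat) (introT eqP k0inf).
  have fin (s : 'I_n) : (s < m)%N -> alpha (t s) != einf.
    by move=> sm; apply/negP => /mmin; rewrite leqNgt sm.
  (* Otherwise the nullity of [T] on [fil m.+1], hence on the whole space, would be infinite. *)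
  have binf : esum_lt (fun k => beta (t k)) m = einf.
    apply/eqP; apply: contrapT => /negP h.
    have := first_infinite a0 b0 st fin minf h.
    by move/eqP; apply/negP; exact: fil_alpha_fin.
  (* Indices start at 0, so this is k >= 2 of the statement; it holds because an empty sum of
     defects is finite. *)
  have m1 : (1 <= m)%N.
    rewrite lt0n; apply/eqP => m0; move: binf; rewrite m0 esum_lt0.
    by [].
  apply: nD1; split; last first.
    (* An infinite sum of defects dominates any sum of nullities. *)
    by rewrite /= (esum_lt_inf binf); case: (esum_all _).
  split; first by exists m => //; split=> //; split=> // s /andP[_]; exact: fin.
  move=> s s0; rewrite /rho_le /sigma_le /=; apply; rewrite (left_fredholm_lsub l (@lD s)).
  apply/fk; split; first by apply: fin; rewrite s0.
  exact: (closed_range_first EE TE lt_ lA bt bA s0 aT cT).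
have notinf k : left_weyl (t k) -> alpha (t k) != einf by case=> /fk [].
(* Conversely, left Weyl entries make [T] left Weyl, and a point of [Delta1] or [Delta2] prevents
   the entry [k] it names from being left Weyl. *)
move=> [[|[[[k _ [kinf _]] _] _]]|[k _ [fin [le_ab bad]]]].
- rewrite wT => nT; apply: contrapT => no.
  have W k : left_weyl (t k) by apply: contrapT => h; apply: no; exists k => //; rewrite wk.
  have fin k : alpha (t k) != einf by exact: notinf.
  have ab k : ele (alpha (t k)) (beta (t k)) by case: (W k).
  have [] := index_le_all a0 b0 st fin ab; rewrite fil_alphan fil_betan => aT abT.
  apply: nT; split=> //; apply/fT; split=> //.
  apply: (closed_range_tri EE TE lt_ lA bt bA fin) => k.
  by case: (W k) => /fk [].
- exists k => //; rewrite wk => /notinf; by rewrite (kinf : alpha (t k) = einf).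
- exists k => //; rewrite wk => -[/fk [_ ck] le_ab_k]; case: bad; last first.
    by apply; apply/HC.
  rewrite /elt => /andP[h1 /eqP]; apply.
  move: le_ab_k h1; rewrite /alphaD /betaD /t; case: alpha => [x|]; case: beta => [y|] //= h1 h2.
  by congr Some; lia.
Qed.
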